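(* Let $0<\rho<1$, and let $B_1(0),B_\rho(0)\subset\mathbb{R}^n$ be the balls of radius $1$ and $\rho$ centered at the origin. Let $Q>0$ be a constant such that $\|u-u_{B_1(0)}\|_{L^2(B_1(0))}\le Q\|\nabla u\|_{L^2(B_1(0))}$ for every $u\in W^{1,2}(B_1(0))$. For $u\in W^{2,2}(B_1(0))$ set $$Tu(x)=u_{B_\rho(0)}+(\nabla u)_{B_\rho(0)}\cdot(x-x_{B_\rho(0)}).$$ Then the operator norm of $T$ on $W^{2,2}(B_1(0))$ satisfies $\|T\|\le\sqrt{\frac{n+3}{n+2}}\left(\frac1\rho\right)^{\frac n2}$, and $$\|u-Tu\|_{W^{2,2}(B_1(0))}\le\left(1+\sqrt{\frac{n+3}{n+2}}\left(\frac1\rho\right)^{\frac n2}\right)(1+Q^2+Q^4)^{\frac12}\|\nabla^2u\|_{L^2(B_1(0))}\quad\text{for every }u\in W^{2,2}(B_1(0)).$$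
   Context: For a measurable set $F$ of positive measure, $f_F=\frac{1}{|F|}\int_F f$ denotes the average of $f$ over $F$ (also for vector valued $f$), and $x_F=\frac{1}{|F|}\int_F x\,dx$ is the center of mass of $F$ (here $x_{B_\rho(0)}=0$). Norm: $\|u\|_{W^{2,2}(\Omega)}=\left(\int_\Omega u^2+|\nabla u|^2+|\nabla^2u|^2\right)^{1/2}$, with the Euclidean (Frobenius) norm on vectors and matrices. The constant $Q$ exists by the classical Poincaré inequality. *)

(* Defs.v *)
From HB Require Import structures.
From mathcomp Require Import all_boot all_order all_algebra.
From mathcomp Require Import all_classical all_reals all_analysis.

Set Implicit Arguments.
Unset Strict Implicit.
Unset Printing Implicit Defensive.

Import Order.TTheory GRing.Theory Num.Theory.
Import numFieldNormedType.Exports.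

Local Open Scope classical_set_scope.
Local Open Scope ring_scope.

Section measurable_rV.
Context {R : realType} (n : nat).

Let coor (i : 'I_n) (x : 'rV[R]_n) : R := x ord0 i.

Let rV_set0 : g_sigma_preimage coor set0.
Proof. exact: sigma_algebra0. Qed.

Let rV_setC A : g_sigma_preimage coor A -> g_sigma_preimage coor (~` A).
Proof. exact: sigma_algebraC. Qed.

Let rV_bigcup (F : (set 'rV[R]_n)^nat) : (forall i, g_sigma_preimage coor (F i)) ->
  g_sigma_preimage coor (\bigcup_i (F i)).
Proof. exact: sigma_algebra_bigcup. Qed.

(* The product sigma-algebra, i.e. the one generated by the coordinates; it is
   the Borel sigma-algebra of 'rV[R]_n. *)
HB.instance Definition _ := @isMeasurable.Build
  (measure_tuple_display default_measure_display)
  'rV[R]_n (g_sigma_preimage coor) rV_set0 rV_setC rV_bigcup.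

End measurable_rV.

Section lebesgue_rV.
Context {R : realType}.

Definition cons_rV n (p : measurableTypeR R * 'rV[R]_n) : 'rV[R]_n.+1 :=
  \row_i if unlift ord0 i is Some j then p.2 ord0 j else p.1.

Definition uncons_rV n (x : 'rV[R]_n.+1) : measurableTypeR R * 'rV[R]_n :=
  (x ord0 ord0, \row_j x ord0 (lift ord0 j)).

Lemma cons_rV0 n (p : measurableTypeR R * 'rV[R]_n) : cons_rV p ord0 ord0 = p.1.
Proof. by rewrite mxE unlift_none. Qed.

Lemma cons_rVS n (p : measurableTypeR R * 'rV[R]_n) (i : 'I_n) :
  cons_rV p ord0 (lift ord0 i) = p.2 ord0 i.
Proof. by rewrite mxE liftK. Qed.

Lemma cons_rVK n : cancel (@cons_rV n) (@uncons_rV n).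
Proof.
case=> a x; rewrite /uncons_rV cons_rV0; congr (_, _).
by apply/rowP => j; rewrite mxE cons_rVS.
Qed.

Lemma uncons_rVK n : cancel (@uncons_rV n) (@cons_rV n).
Proof.
move=> x; apply/rowP => i; case: (unliftP ord0 i) => [j|] ->.
  by rewrite cons_rVS mxE.
by rewrite cons_rV0.
Qed.

Lemma measurable_coor n (i : 'I_n) :
  measurable_fun [set: 'rV[R]_n] (fun x => x ord0 i).
Proof.
move=> _ Y mY; rewrite setTI; apply: sub_sigma_algebra => /=.
rewrite -bigcup_seq/=; exists i => /=; first by rewrite mem_index_enum.
by exists Y => //; rewrite setTI.
Qed.

Lemma measurable_fun_rVP d (T : measurableType d) n (f : T -> 'rV[R]_n) :
  measurable_fun [set: T] f <->
  forall i, measurable_fun [set: T] (fun t => f t ord0 i).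
Proof.
split=> [mf i|mf].
  by apply: (measurableT_comp (measurable_coor i)).
move=> _ A mA; rewrite setTI.
have : preimage_set_system setT f measurable (f @^-1` A).
  by exists A => //; rewrite setTI.
rewrite -[X in X _ -> _]g_sigma_preimage_comp; move: (_ @^-1` _).
apply: smallest_sub; first exact: sigma_algebra_measurable.
case: n => [|n] in f mf A mA *; first by rewrite big_ord0.
rewrite -bigcup_mkord_ord; apply: bigcup_sub => i Ii.
by move=> B [C mC <-]; exact: mf.
Qed.

Lemma measurable_cons_rV n : measurable_fun setT (@cons_rV n).
Proof.
apply/measurable_fun_rVP => i; case: (unliftP ord0 i) => [j|] ->.
  under eq_fun do rewrite cons_rVS.
  exact: (measurableT_comp (measurable_coor j)).
under eq_fun do rewrite cons_rV0.
exact: measurable_fst.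
Qed.

Lemma measurable_uncons_rV n : measurable_fun setT (@uncons_rV n).
Proof.
apply/measurable_fun_pairP; split; first exact: measurable_coor.
apply/measurable_fun_rVP => i /=.
under eq_fun do rewrite /= mxE.
exact: measurable_coor.
Qed.

Section step.
Variables (n : nat) (mu : {sigma_finite_measure set 'rV[R]_n -> \bar R}).

Definition lebesgue_rV_step : set 'rV[R]_n.+1 -> \bar R :=
  pushforward (lebesgue_measure \x mu)%E (@cons_rV n).

Let lebesgue_rV_step_measurable (A : set 'rV[R]_n.+1) :
  measurable A -> measurable (@cons_rV n @^-1` A).
Proof.
by move=> mA; rewrite -[X in measurable X]setTI; exact: measurable_cons_rV.
Qed.

Let lebesgue_rV_step0 : lebesgue_rV_step set0 = 0%E.
Proof. by rewrite /lebesgue_rV_step /pushforward preimage_set0 measure0. Qed.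

Let lebesgue_rV_step_ge0 A : (0 <= lebesgue_rV_step A)%E.
Proof. by rewrite /lebesgue_rV_step /pushforward. Qed.

Let lebesgue_rV_step_sigma_additive : semi_sigma_additive lebesgue_rV_step.
Proof.
move=> F mF tF mUF; rewrite /lebesgue_rV_step /pushforward preimage_bigcup.
apply: measure_semi_sigma_additive.
- by move=> k; exact: lebesgue_rV_step_measurable.
- apply/trivIsetP => /= i j _ _ ij; rewrite -preimage_setI.
  by move/trivIsetP : tF => /(_ _ _ _ _ ij) ->//; rewrite preimage_set0.
- by rewrite -preimage_bigcup; exact: lebesgue_rV_step_measurable.
Qed.

HB.instance Definition _ := isMeasure.Build _ _ _ lebesgue_rV_step
  lebesgue_rV_step0 lebesgue_rV_step_ge0 lebesgue_rV_step_sigma_additive.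

Let lebesgue_rV_step_sigma_finite : sigma_finite setT lebesgue_rV_step.
Proof.
have [F FT Foo] : sigma_finite setT (lebesgue_measure \x mu)%E.
  have /sigma_finiteP[F [TF ndF Foo]] := sigma_finiteT (@lebesgue_measure R).
  have /sigma_finiteP[G [TG ndG Goo]] := sigma_finiteT mu.
  exists (fun k => F k `*` G k).
    rewrite -setXTT TF TG predeqE => -[x y]; split.
      move=> [/= [k _ Fkx] [l _ Gly]]; exists (maxn k l) => //=.
      split.
      - by move: x Fkx; exact/subsetPset/ndF/leq_maxl.
      - by move: y Gly; exact/subsetPset/ndG/leq_maxr.
    by move=> [k _ []/= ? ?]; split; exists k.
  move=> k; have [mF Fk] := Foo k; have [mG Gk] := Goo k.
  split; first exact: measurableX.
  by rewrite product_measure1E// lte_mul_pinfty// ge0_fin_numE.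
exists (fun k => @uncons_rV n @^-1` F k).
  by rewrite -preimage_bigcup -FT preimage_setT.
move=> k; have [mF Fk] := Foo k; split.
  by rewrite -[X in measurable X]setTI; exact: measurable_uncons_rV.
rewrite /lebesgue_rV_step /pushforward.
rewrite (_ : _ @^-1` _ = F k)//.
by apply/seteqP; split => p /=; rewrite cons_rVK.
Qed.

HB.instance Definition _ := Measure_isSigmaFinite.Build _ _ _
  lebesgue_rV_step lebesgue_rV_step_sigma_finite.

End step.

Fixpoint lebesgue_rV (n : nat) : {sigma_finite_measure set 'rV[R]_n -> \bar R} :=
  match n with
  | 0%N => \d_(0 : 'rV[R]_0)
  | m.+1 => lebesgue_rV_step (lebesgue_rV m)
  end.

Lemma lebesgue_rV_box n (a b : 'rV[R]_n) :
  (forall i, a ord0 i <= b ord0 i) ->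
  lebesgue_rV n [set x | forall i, x ord0 i \in `]a ord0 i, b ord0 i]] =
  (\prod_(i < n) (b ord0 i - a ord0 i))%:E.
Proof.
elim: n a b => [|n IH] a b ab.
  rewrite big_ord0 /= diracE mem_set//= => -[]//.
rewrite big_ord_recl /= /lebesgue_rV_step /pushforward.
pose a' : 'rV[R]_n := (uncons_rV a).2; pose b' : 'rV[R]_n := (uncons_rV b).2.
pose I : set (measurableTypeR R) := `]a ord0 ord0, b ord0 ord0]%classic.
pose J := [set x : 'rV[R]_n | forall i, x ord0 i \in `]a' ord0 i, b' ord0 i]].
transitivity ((@lebesgue_measure R \x lebesgue_rV n)%E (I `*` J)).
  congr (product_measure1 _ _); apply/seteqP; split => p /=.
    move=> H; split => [|i]; first by have := H ord0; rewrite cons_rV0.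
    by have := H (lift ord0 i); rewrite cons_rVS !mxE.
  move=> [H0 H] i; case: (unliftP ord0 i) => [j|] ->; last by rewrite cons_rV0.
  by have := H j; rewrite cons_rVS !mxE.
have mI : measurable I by exact: measurable_itv.
have mJ : measurable J.
  rewrite (_ : J = \big[setI/setT]_(i < n)
     ((fun x : 'rV[R]_n => x ord0 i) @^-1` `]a' ord0 i, b' ord0 i])); last first.
    apply/seteqP; split => x /=.
      by move=> H; rewrite -bigcap_seq/= => i _; exact: H.
    by rewrite -bigcap_seq/= => H i; apply: H; rewrite /= mem_index_enum.
  apply: big_ind => //; first by move=> *; exact: measurableI.
  move=> i _; rewrite -[X in measurable X]setTI.
  by apply: measurable_coor => //; exact: measurable_itv.
rewrite product_measure1E//.
rewrite IH; last by move=> i; rewrite !mxE.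
rewrite EFinM; congr (_ * _)%E.
  apply: etrans (lebesgue_measure_itv `]a ord0 ord0, b ord0 ord0]) _.
  rewrite /= lte_fin; case: ltP => // h; congr (_%:E).
  by apply/eqP; rewrite eq_sym subr_eq0 eq_le h ab.
by congr (_%:E); apply: eq_bigr => i _; rewrite !mxE.
Qed.

End lebesgue_rV.
Arguments lebesgue_rV {R} n.

Section euclidean.
Context {R : realType}.

(* Frobenius norm; on row vectors it is the Euclidean norm. (The library norm
   on matrices is the sup norm.) *)
Definition fnorm m n (A : 'M[R]_(m, n)) : R :=
  Num.sqrt (\sum_(i < m) \sum_(j < n) A i j ^+ 2).

Definition eball n (r : R) : set 'rV[R]_n := [set x | fnorm x < r].

Definition average n (F : set 'rV[R]_n) (f : 'rV[R]_n -> R) : R :=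
  (fine (lebesgue_rV n F))^-1 * \int[lebesgue_rV n]_(x in F) f x.

Definition center_of_mass n (F : set 'rV[R]_n) : 'rV[R]_n :=
  \row_i average F (fun x => x ord0 i).

End euclidean.
Arguments eball {R} n r.

Section sobolev.
Context {R : realType} {n : nat}.
Local Notation E := 'rV[R]_n.
Implicit Types (Omega : set E) (u v : E -> R) (i j : 'I_n).

Definition partial i (f : E -> R) : E -> R := 'D_(delta_mx ord0 i) f.

Definition partials (s : seq 'I_n) (f : E -> R) : E -> R := foldr partial f s.

Definition smooth (f : E -> R) : Prop := forall s : seq 'I_n,
  continuous (partials s f) /\
  forall i x, derivable (partials s f) x (delta_mx ord0 i).

Definition test_function Omega (phi : E -> R) : Prop :=
  [/\ smooth phi, compact (closure [set x | phi x != 0]) &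
      closure [set x | phi x != 0] `<=` Omega].

Definition locally_integrable Omega u : Prop :=
  measurable_fun Omega u /\
  forall K : set E, compact K -> K `<=` Omega ->
    (lebesgue_rV n).-integrable K (EFin \o u).

Definition is_weak_partial Omega i u v : Prop :=
  [/\ locally_integrable Omega u, locally_integrable Omega v &
      forall phi, test_function Omega phi ->
        \int[lebesgue_rV n]_(x in Omega) (u x * partial i phi x) =
        - \int[lebesgue_rV n]_(x in Omega) (v x * phi x)].

(* A chosen representative of the weak derivative, which is unique up to
   equality almost everywhere; junk value 0 if there is none. *)
Definition weak_partial Omega i u : E -> R :=
  xget (cst 0) [set v | is_weak_partial Omega i u v].

Definition grad Omega u (x : E) : 'rV[R]_n := \row_i weak_partial Omega i u x.

Definition hess Omega u (x : E) : 'M[R]_n :=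
  \matrix_(i, j) weak_partial Omega j (weak_partial Omega i u) x.

Definition L2norm Omega u : \bar R :=
  ((\int[lebesgue_rV n]_(x in Omega) ((u x) ^+ 2)%:E) `^ 2^-1)%E.

Definition L2 Omega u : Prop :=
  measurable_fun Omega u /\ (L2norm Omega u < +oo)%E.

Definition W12 Omega u : Prop :=
  L2 Omega u /\ forall i, exists2 v, L2 Omega v & is_weak_partial Omega i u v.

Definition W22 Omega u : Prop :=
  W12 Omega u /\ forall i, W12 Omega (weak_partial Omega i u).

Definition W22norm Omega u : \bar R :=
  ((\int[lebesgue_rV n]_(x in Omega)
     (u x ^+ 2 + fnorm (grad Omega u x) ^+ 2 + fnorm (hess Omega u x) ^+ 2)%:E)
   `^ 2^-1)%E.

Definition W22_opnorm Omega (T : (E -> R) -> E -> R) : \bar R :=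
  ereal_sup [set W22norm Omega (T u) |
             u in [set u | W22 Omega u /\ (W22norm Omega u <= 1)%E]].

(* u |-> u_F + (grad u)_F . (x - x_F), where F is a subset of Omega and grad u
   is the weak gradient of u on Omega. *)
Definition affine_approx Omega (F : set E) u (x : E) : R :=
  average F u + \sum_(i < n)
    average F (fun y => grad Omega u y ord0 i) *
    (x ord0 i - center_of_mass F ord0 i).

End sobolev.

(* Main.v *)
(** Everything takes place on the unit ball B, with F the concentric ball of
    radius rho.  Since F is centred at the origin, Tu is the affine function
    a + b.x, where a and b are the averages of u and of its gradient on F.

    The second moments of B follow from integrating the divergence of
    (a + b x_j) (1 - |x|^2) e_i, which vanishes on the sphere: the mixed moments
    are 0 and each x_i^2 has mean 1/(n+2).  Hence ||Tu||^2 is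
    |B| (a^2 + (n+3)/(n+2) |b|^2), and Jensen's inequality on F together with
    |F| = rho^n |B| bounds it by ((n+3)/(n+2)) rho^-n ||u||^2.

    For the second estimate let l be the affine function built from the averages
    on B, and w = u - l.  As T fixes affine functions, u - Tu = w - Tw, whose norm
    is at most (1 + C) ||w||; and the Poincare inequality, applied to w and to each
    partial derivative of u, gives ||w||^2 <= (1 + Q^2 + Q^4) ||D^2 u||^2.

    Weak derivatives are only chosen representatives, so one needs their
    uniqueness almost everywhere.  It is obtained by testing against products of
    the functions exp(-1/t), which approximate the indicators of boxes; boxes
    form a pi-system generating the Borel sets. *)
Require Import Defs.
From HB Require Import structures.
From mathcomp Require Import all_boot all_order all_algebra.
From mathcomp Require Import all_classical all_reals all_analysis.
From mathcomp Require Import measurable_realfun ring lra zify.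
Set Implicit Arguments.
Unset Strict Implicit.
Unset Printing Implicit Defensive.
Import Order.TTheory GRing.Theory Num.Theory.
Import numFieldNormedType.Exports.
Local Open Scope classical_set_scope.
Local Open Scope ring_scope.

(** * Boxes and Lebesgue measure *)

Section rV_borel.
Context {R : realType} {n : nat}.
Local Notation E := 'rV[R]_n.
Implicit Types (a b x : E).

(** Left-open and right-closed sides, as in [lebesgue_rV_box]; the form is stable under
    intersection, and the endpoints need not be ordered. *)
Definition box a b : set E := [set x | forall i, x ord0 i \in `]a ord0 i, b ord0 i]].

Definition boxes : set (set E) := [set box p.1 p.2 | p in [set: E * E]].

Lemma measurable_box a b : measurable (box a b).
Proof.
rewrite (_ : box a b = \bigcap_(i in [set: 'I_n])
    ((fun x : E => x ord0 i) @^-1` `]a ord0 i, b ord0 i]%classic)).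
  apply: fin_bigcap_measurable => // i _.
  rewrite -[X in measurable X]setTI.
  by apply: measurable_coor => //; exact: measurable_itv.
by apply/seteqP; split => [x abx i _|x abx i]; [exact: abx|exact: (abx i)].
Qed.

Lemma setI_closed_boxes : setI_closed boxes.
Proof.
move=> _ _ [[a b] _ <-] [[c d] _ <-] /=.
exists (\row_i Num.max (a ord0 i) (c ord0 i),
        \row_i Num.min (b ord0 i) (d ord0 i)) => //=.
apply/seteqP; split => x /=.
  move=> H; split => i; have := H i; rewrite !mxE !in_itv/= gt_max le_min;
    by move=> /andP[/andP[h1 h2] /andP[h3 h4]]; rewrite ?h1 ?h2 ?h3 ?h4.
move=> [H1 H2] i; have := H1 i; have := H2 i; rewrite !mxE !in_itv/= gt_max le_min.
by move=> /andP[-> ->] /andP[-> ->].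
Qed.

Lemma rV_norm_ltnat (x : E) : exists k : nat, forall i, `|x ord0 i| < k%:R.
Proof.
exists (Num.bound (\sum_i `|x ord0 i|)) => i.
apply: le_lt_trans (archi_boundP _); last exact: sumr_ge0.
by rewrite (bigD1 i)//= lerDl sumr_ge0.
Qed.

(** The product sigma-algebra is generated by the coordinates, so it is enough to write each
    half-space [x_i > r] as a countable union of boxes. *)
Lemma measurable_rVE : @measurable _ E = <<s boxes >>.
Proof.
apply/seteqP; split; last first.
  apply: smallest_sub; first exact: sigma_algebra_measurable.
  by move=> _ [[a b] _ <-]; exact: measurable_box.
have mcoor (i : 'I_n) : @measurable_fun _ _ (g_sigma_algebraType boxes) R setT
    (fun x : E => x ord0 i).
  apply: (measurability _ (RGenOInfty.measurableE R)) => _ [_ [r ->] <-].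
  rewrite setTI.
  (* The lower bound is [r] in direction [i] and [- k] in the others, the upper bound is [k]: the
     union over [k] removes every constraint except [x_i > r]. *)
  rewrite (_ : _ @^-1` _ = \bigcup_k box (\row_j if j == i then r else - k%:R)
                                        (const_mx k%:R)).
    apply: bigcup_measurable => k _; apply: sub_sigma_algebra.
    by exists (\row_j (if j == i then r else - k%:R), const_mx k%:R).
  apply/seteqP; split => x /=.
    rewrite in_itv/= andbT => rx; have [k xk] := rV_norm_ltnat x.
    exists k => //= j; have := xk j; rewrite in_itv/= !mxE ltr_norml.
    by move=> /andP[kx /ltW ->]; rewrite andbT; case: eqP => // ->.
  move=> [k _ /(_ i)]; rewrite in_itv/= !mxE eqxx => /andP[rx _].
  by rewrite in_itv/= rx.
apply: smallest_sub; first exact: smallest_sigma_algebra.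
rewrite -bigcup_seq => B [i _ [Y mY <-]].
exact: mcoor.
Qed.

(** Uniqueness on a generating pi-system; the cubes []-k, k]^n] exhaust the space. *)
Lemma rV_measure_unique (m1 m2 : {measure set E -> \bar R}) :
  (forall a b, m1 (box a b) = m2 (box a b)) ->
  (forall a b, (m1 (box a b) < +oo)%E) ->
  forall A, measurable A -> m1 A = m2 A.
Proof.
move=> m12 m1oo A mA.
pose g k : set E := box (const_mx (- k%:R)) (const_mx k%:R).
apply: (@measure_unique _ _ _ boxes g) => //.
- exact: measurable_rVE.
- exact: setI_closed_boxes.
- by move=> k; exists (const_mx (- k%:R), const_mx k%:R).
- apply/seteqP; split => // x _; have [k xk] := rV_norm_ltnat x; exists k => //= i.
  by have := xk i; rewrite in_itv/= !mxE ltr_norml => /andP[-> /ltW ->].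
- by move=> _ [[a b] _ <-].
- by move=> k; exact: m1oo.
Qed.

Lemma box0 a b i : b ord0 i < a ord0 i -> box a b = set0.
Proof.
move=> ba; apply/seteqP; split => // x /(_ i); rewrite in_itv/= => /andP[ax xb].
by have := lt_le_trans ax xb; rewrite ltNge (ltW ba).
Qed.

Lemma lebesgue_rV_box_lty a b : (lebesgue_rV n (box a b) < +oo)%E.
Proof.
have [ab|] := pselect (forall i, a ord0 i <= b ord0 i).
  by rewrite lebesgue_rV_box// ltry.
by move=> /existsNP[i /negP]; rewrite -ltNge => /box0 ->; rewrite measure0.
Qed.

Definition homothety (c : R) (t : E) (x : E) : E := c *: x + t.

Lemma measurable_homothety c t : measurable_fun setT (homothety c t).
Proof.
apply/measurable_fun_rVP => i; under eq_fun do rewrite !mxE.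
apply: measurable_funD => //; apply: measurable_funM => //.
exact: measurable_coor.
Qed.

(** Both sides are measures in [A]. They agree on boxes, because the preimage of a box under
    [homothety c t] is a box with sides divided by [c]. *)
Lemma lebesgue_rV_homothety (c : R) (t : E) (A : set E) : 0 < c -> measurable A ->
  ((c ^+ n)%:E * lebesgue_rV n (homothety c t @^-1` A))%E = lebesgue_rV n A.
Proof.
move=> c0 mA.
pose m1 := mscale (NngNum (exprn_ge0 n (ltW c0)))
  (measure_function_pushforward__canonical__measure_function_Measure
    (lebesgue_rV n) (measurable_homothety c t)).
suff : m1 A = lebesgue_rV n A by [].
have pre a b : homothety c t @^-1` box a b =
    box (c^-1 *: (a - t)) (c^-1 *: (b - t)).
  apply/seteqP; split => x H i; have := H i; rewrite !in_itv/= !mxE => /andP[h1 h2];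
  apply/andP; split.
  - by rewrite mulrC ltr_pdivrMr// mulrC ltrBlDr.
  - by rewrite mulrC ler_pdivlMr// mulrC lerBrDr.
  - by move: h1; rewrite mulrC ltr_pdivrMr// mulrC ltrBlDr.
  - by move: h2; rewrite mulrC ler_pdivlMr// mulrC lerBrDr.
have m1E a b : m1 (box a b) = lebesgue_rV n (box a b).
  rewrite /m1 /mscale/= /pushforward pre.
  have [ab|] := pselect (forall i, a ord0 i <= b ord0 i); last first.
    move=> /existsNP[i /negP]; rewrite -ltNge => ba.
    rewrite (box0 ba) (@box0 _ _ i) ?measure0 ?mule0//.
    by rewrite !mxE ltr_pM2l ?invr_gt0// ltrD2r.
  rewrite !lebesgue_rV_box//; last first.
    by move=> i; rewrite !mxE ler_pM2l ?invr_gt0// lerD2r.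
  rewrite -EFinM; congr (_%:E).
  have -> : c ^+ n = \prod_(i < n) c by rewrite prodr_const card_ord.
  rewrite -big_split/=; apply: eq_bigr => i _; rewrite !mxE.
  by field; rewrite gt_eqF.
apply: rV_measure_unique => // a b.
by have := lebesgue_rV_box_lty a b; rewrite -m1E.
Qed.

(** An open set is the union of the sup-norm cubes with rational centre and radius [1/(k+1)] that it
    contains, and there are countably many such cubes. *)
Lemma open_measurable_rV (U : set E) : open U -> measurable U.
Proof.
move=> oU.
pose V (p : 'rV[rat]_n * nat) : set E :=
  [set x : E | forall i, `|x ord0 i - ratr (p.1 ord0 i)| < p.2.+1%:R^-1].
have mV p : measurable (V p).
  rewrite (_ : V p = \bigcap_(i in [set: 'I_n]) ((fun x : E => x ord0 i) @^-1`
      [set r | `|r - ratr (p.1 ord0 i)| < p.2.+1%:R^-1])).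
    apply: fin_bigcap_measurable => // i _; rewrite -[X in measurable X]setTI.
    apply: measurable_coor => //; apply: open_measurable.
    have := @ball_open R R (ratr (p.1 ord0 i)) (p.2.+1%:R^-1); rewrite -ball_normE /ball_/=.
    by under eq_set do rewrite distrC; apply; rewrite invr_gt0.
  by apply/seteqP; split => [x abx i _|x abx i]; [exact: abx|exact: (abx i)].
rewrite (_ : U = \bigcup_(p in [set: 'rV[rat]_n * nat]) (if `[< V p `<=` U >] then V p else set0)).
  apply: countable_bigcupT_measurable; first exact: countableP.
  by move=> p; case: ifPn.
apply/seteqP; split => x; last first.
  by move=> [p _]; case: asboolP => // VU /VU.
move=> Ux; have := open_nbhs_nbhs (conj oU Ux) => /nbhs_ballP[e /= e0 xeU].
(* Half of [e], since [x] and [y] are each within [1/(k+1)] of the rational centre. *)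
have [k ke] : exists k, k.+1%:R^-1 < e / 2 :> R.
  exists (Num.bound (e / 2)^-1); rewrite invf_plt ?posrE ?divr_gt0//.
  apply: lt_trans (archi_boundP _) _; first by rewrite invr_ge0 divr_ge0// ltW.
  by rewrite ltr_nat.
have k0 : (0 : R) < k.+1%:R^-1 by rewrite invr_gt0.
have H i : exists q : rat, `|x ord0 i - ratr q| < k.+1%:R^-1.
  have [|q] := @rat_in_itvoo R (x ord0 i - k.+1%:R^-1) (x ord0 i + k.+1%:R^-1).
    by rewrite ltrD2l; apply: lt_trans k0; rewrite oppr_lt0.
  by rewrite in_itv/= => ?; exists q; rewrite distrC ltr_distl.
have {H}[q qP] := choice H.
exists (\row_i q i, k) => //.
case: asboolP; first by move=> _ i /=; rewrite mxE.
case=> y Vy; apply: xeU; split=> // i j.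
rewrite (_ : i = ord0); last exact: ord1.
have := Vy j; have := qP j; rewrite /= mxE -ball_normE /ball_/= => h1 h2.
move: ke h1 h2; rewrite !ltr_norml; move: (k.+1%:R^-1) (ratr (q j)) => d r.
by move=> ? /andP[? ?] /andP[? ?]; apply/andP; split; lra.
Qed.

Lemma continuous_measurable_rV (f : E -> R) : continuous f -> measurable_fun setT f.
Proof.
move=> /continuousP cf; apply: (measurability _ (RGenOpens.measurableE R)).
move=> _ [_ [r [s ->]] <-]; rewrite setTI; apply: open_measurable_rV.
by apply: cf; exact: interval_open.
Qed.

Lemma compact_measurable_rV (K : set E) : compact K -> measurable K.
Proof.
move=> /compact_closed cK; rewrite -[K]setCK; apply: measurableC.
by apply: open_measurable_rV; apply: closed_openC; apply: cK; exact: norm_hausdorff.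
Qed.

End rV_borel.

(** * Real-valued integrable functions *)

Section real_integrable.
Context d (T : measurableType d) (R : realType) (mu : {measure set T -> \bar R}).
Variables (D : set T) (mD : measurable D).
Implicit Types f g : T -> R.

Lemma integrable_EFinD f g : mu.-integrable D (EFin \o f) ->
  mu.-integrable D (EFin \o g) -> mu.-integrable D (EFin \o (fun x => f x + g x)).
Proof. by move=> fi gi; apply: eq_integrable (integrableD mD fi gi). Qed.

Lemma integrable_EFinB f g : mu.-integrable D (EFin \o f) ->
  mu.-integrable D (EFin \o g) -> mu.-integrable D (EFin \o (fun x => f x - g x)).
Proof. by move=> fi gi; apply: eq_integrable (integrableB mD fi gi). Qed.

Lemma integrable_EFinZ (c : R) f : mu.-integrable D (EFin \o f) ->
  mu.-integrable D (EFin \o (fun x => c * f x)).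
Proof. by move=> fi; apply: eq_integrable (integrableZl mD c fi). Qed.

Lemma integrable_EFin_sum I (s : seq I) (h : I -> T -> R) :
  (forall i, mu.-integrable D (EFin \o h i)) ->
  mu.-integrable D (EFin \o (fun x => \sum_(i <- s) h i x)).
Proof.
move=> hi; apply: eq_integrable (integrable_sum mD s (P := predT) (fun i _ => hi i)) => //.
by move=> x _ /=; rewrite -sumEFin.
Qed.

Lemma integrable_EFin_bounded (M : R) f : (mu D < +oo)%E -> measurable_fun D f ->
  (forall x, D x -> `|f x| <= M) -> mu.-integrable D (EFin \o f).
Proof.
move=> muD mf fM; apply: measurable_bounded_integrable => //.
exists M; split; first exact: num_real.
by move=> y My x Dx; exact: le_trans (fM x Dx) (ltW My).
Qed.

Lemma le_integrable_EFin f g : measurable_fun D f ->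
  (forall x, D x -> `|f x| <= g x) -> mu.-integrable D (EFin \o g) ->
  mu.-integrable D (EFin \o f).
Proof.
move=> mf fg; apply: le_integrable => //; first exact/measurable_EFinP.
by move=> x Dx /=; rewrite lee_fin (le_trans (fg x Dx))// ler_norm.
Qed.

Lemma Rintegral_sumr I (s : seq I) (h : I -> T -> R) :
  (forall i, mu.-integrable D (EFin \o h i)) ->
  \int[mu]_(x in D) (\sum_(i <- s) h i x) = \sum_(i <- s) \int[mu]_(x in D) h i x.
Proof.
move=> hi; elim: s => [|i s IH].
  under eq_Rintegral do rewrite big_nil; rewrite big_nil.
  by rewrite Rintegral_cst// mul0r.
under eq_Rintegral do rewrite big_cons; rewrite big_cons RintegralD//.
  by rewrite IH.
exact: integrable_EFin_sum.
Qed.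

Lemma EFin_Rintegral f : mu.-integrable D (EFin \o f) ->
  (\int[mu]_(x in D) (f x)%:E)%E = (\int[mu]_(x in D) f x)%:E.
Proof. by move=> fi; rewrite /Rintegral fineK//; exact: integrable_fin_num. Qed.

Lemma ae_eq_EFin f g : ae_eq mu D f g -> ae_eq mu D (EFin \o f) (EFin \o g).
Proof. by apply: filterS => x /= fg Dx; rewrite fg. Qed.

Lemma ae_eq_Rintegral f g : measurable_fun D f -> measurable_fun D g ->
  ae_eq mu D f g -> \int[mu]_(x in D) f x = \int[mu]_(x in D) g x.
Proof.
move=> mf mg fg; rewrite /Rintegral; congr fine.
by apply: ae_eq_integral => //; [exact/measurable_EFinP..|exact: ae_eq_EFin].
Qed.

Lemma ae_eq_integrable f g : measurable_fun D f -> measurable_fun D g ->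
  ae_eq mu D f g -> mu.-integrable D (EFin \o f) -> mu.-integrable D (EFin \o g).
Proof.
move=> mf mg fg /integrableP[_ fi]; apply/integrableP; split; first exact/measurable_EFinP.
rewrite (ae_eq_integral (fun x => `|(EFin \o f) x|%E))//.
- by apply: measurableT_comp => //; exact/measurable_EFinP.
- by apply: measurableT_comp => //; exact/measurable_EFinP.
- by apply: filterS fg => x /= fg Dx; rewrite fg.
Qed.

(** Domination by [|f g| <= f^2 + g^2]. *)
Lemma integrable_EFin_mul f g : measurable_fun D f -> measurable_fun D g ->
  mu.-integrable D (EFin \o (fun x => f x ^+ 2)) ->
  mu.-integrable D (EFin \o (fun x => g x ^+ 2)) ->
  mu.-integrable D (EFin \o (fun x => f x * g x)).
Proof.
move=> mf mg fi gi; apply: le_integrable_EFin (integrable_EFinD fi gi).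
  exact: measurable_funM.
move=> x Dx; rewrite ler_norml; apply/andP; split; nra.
Qed.

End real_integrable.

(** * Translation invariance *)

Section translation.
Context {R : realType} {n : nat}.
Local Notation E := 'rV[R]_n.
Local Notation mu := (@lebesgue_rV R n).

Lemma measurable_translation (t : E) : measurable_fun setT (fun x : E => x + t).
Proof.
apply: eq_measurable_fun (measurable_homothety 1 t) => x _.
by rewrite /homothety scale1r.
Qed.

Lemma lebesgue_rV_translation (t : E) (A : set E) : measurable A ->
  mu ((fun x => x + t) @^-1` A) = mu A.
Proof.
move=> mA; rewrite -[RHS](@lebesgue_rV_homothety _ _ 1 t)// expr1n mul1e.
by congr (mu _); apply/seteqP; split => x /=; rewrite /homothety scale1r.
Qed.

Lemma ge0_integral_translation (t : E) (f : E -> \bar R) :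
  measurable_fun setT f -> (forall x, (0 <= f x)%E) ->
  (\int[mu]_x f (x + t)%R = \int[mu]_x f x)%E.
Proof.
move=> mf f0.
have := ge0_integral_pushforward (measurable_translation t) mu measurableT mf (fun y _ => f0 y).
rewrite preimage_setT => <-; apply: eq_measure_integral => [|mt A mA _].
  exact: measurable_translation.
exact: lebesgue_rV_translation.
Qed.

Lemma integrable_translation (t : E) (f : E -> \bar R) :
  mu.-integrable setT f -> mu.-integrable setT (fun x => f (x + t)).
Proof.
move=> /integrableP[mf fi]; apply/integrableP; split.
  exact: (measurableT_comp mf (measurable_translation t)).
by rewrite (ge0_integral_translation t (f := fun x => `|f x|%E))//; exact: measurableT_comp.
Qed.

Lemma Rintegral_translation (t : E) (f : E -> R) : mu.-integrable setT (EFin \o f) ->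
  \int[mu]_x f (x + t) = \int[mu]_x f x.
Proof.
move=> fi; rewrite /Rintegral; congr fine.
have ft := integrable_translation t fi.
have /integrableP[mf _] := fi.
have := integral_pushforward (measurable_translation t) (mu := mu) (D := setT) mf.
rewrite preimage_setT => /(_ ft measurableT) <-.
apply: eq_measure_integral => [|mt A mA _].
  exact: measurable_translation.
exact: lebesgue_rV_translation.
Qed.

Lemma integrable_rV_bounded_support (a b : E) (M : R) (f : E -> R) :
  measurable_fun setT f -> (forall x, `|f x| <= M) ->
  (forall x, ~ box a b x -> f x = 0) -> mu.-integrable setT (EFin \o f).
Proof.
move=> mf fM f0.
have mb := measurable_box a b.
have /(integrable_mkcond _ mb) : mu.-integrable (box a b) (EFin \o f).
  apply: (integrable_EFin_bounded mb (M := M)) => //; first exact: lebesgue_rV_box_lty.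
  exact: measurable_funTS.
apply: eq_integrable => // x _; rewrite patchE; case: ifPn => // /negP.
by rewrite inE => /f0 /= ->.
Qed.

(* Translation invariance makes the integral of every difference quotient
   vanish, and dominated convergence passes to the limit. *)
Lemma Rintegral_partial0 (i : 'I_n) (g d : E -> R) (M L : R) : 0 <= M ->
  measurable_fun setT g -> measurable_fun setT d ->
  mu.-integrable setT (EFin \o g) ->
  (forall (x : E) j, M < `|x ord0 j| -> g x = 0) ->
  (forall (x : E) (h : R), 0 <= h <= 1 -> `|g (x + h *: delta_mx ord0 i) - g x| <= L * h) ->
  {ae mu, forall x : E, (fun k => k.+1%:R * (g (x + k.+1%:R^-1 *: delta_mx ord0 i) - g x))
     @ \oo --> d x} ->
  mu.-integrable setT (EFin \o d) /\ \int[mu]_x d x = 0.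
Proof.
move=> M0 mg md gi g0 gL gd.
pose q k (x : E) := k.+1%:R * (g (x + k.+1%:R^-1 *: delta_mx ord0 i) - g x).
have mq k : measurable_fun setT (q k).
  apply: measurable_funM => //; apply: measurable_funB => //.
  exact: (measurableT_comp mg (measurable_translation _)).
have hk k : 0 <= (k.+1%:R^-1 : R) <= 1.
  by rewrite invr_ge0 ler0n/= invf_le1// ler1n.
have qL k x : `|q k x| <= L.
  rewrite /q normrM ger0_norm// mulrC.
  by have := gL x _ (hk k); rewrite -ler_pdivlMr ?invr_gt0// invrK.
(* A shift by [1/(k+1) <= 1] changes a coordinate by at most 1, so both terms of every difference
   quotient vanish outside this box. *)
pose B : set E := box (const_mx (- (M + 2))) (const_mx (M + 2)).
have q0 k x : ~ B x -> q k x = 0.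
  move=> /existsNP[j /negP]; rewrite in_itv/= !mxE negb_and -leNgt -ltNge => xj.
  have xM : M + 2 <= `|x ord0 j|.
    case/orP: xj => xj; rewrite ler_normr; first by rewrite lerNr xj orbT.
    by rewrite (ltW xj).
  rewrite /q (g0 x j) ?(g0 _ j) ?subrr ?mulr0//; last lra.
  rewrite !mxE; apply: (@lt_le_trans _ _ (M + 1)); first by rewrite ltrDl.
  rewrite (le_trans _ (lerB_normD _ _))//.
  suff : `|k.+1%:R^-1 * ((0 == 0 :> 'I_1) && (j == i))%:R| <= 1 :> R by lra.
  have /andP[h1 h2] := hk k; rewrite normrM !ger0_norm// ?ler0n//.
  by case: (_ && _); rewrite ?mulr1 ?mulr0.
pose G (x : E) := L * \1_B x.
have mB : measurable B by exact: measurable_box.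
have Gi : mu.-integrable setT (EFin \o G).
  apply: (@integrable_rV_bounded_support (const_mx (- (M + 2))) (const_mx (M + 2)) `|L|).
  - by apply: measurable_funM => //; exact: measurable_indic.
  - move=> x; rewrite /G normrM indicE; case: (_ \in _) => /=.
      by rewrite normr1 mulr1.
    by rewrite normr0 mulr0.
  - by move=> x Bx; rewrite /G indicE memNset// mulr0.
have [] := @dominated_convergence _ _ _ mu setT measurableT
  (fun k x => (q k x)%:E) (EFin \o d) (EFin \o G).
- by move=> k; exact/measurable_EFinP.
- exact/measurable_EFinP.
- by apply: filterS gd => x gdx _; apply/cvg_EFin => //; exact: nearW.
- exact: Gi.
- apply: aeW => x k _; rewrite /= /G indicE lee_fin.
  case: (boolP (x \in B)) => [_|/negP]; first by rewrite mulr1.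
  by rewrite inE => /(q0 k) ->; rewrite normr0 mulr0.
move=> di _ lim; split=> //.
have int0 k : (\int[mu]_x (q k x)%:E = 0)%E.
  have gti : mu.-integrable setT (EFin \o (fun x => g (x + k.+1%:R^-1 *: delta_mx ord0 i))).
    exact: integrable_translation gi.
  rewrite EFin_Rintegral//.
    rewrite /q RintegralZl//; last exact: integrable_EFinB.
    by rewrite RintegralB// Rintegral_translation// subrr mulr0.
  exact: (integrable_EFinZ measurableT k.+1%:R (integrable_EFinB measurableT gti gi)).
rewrite /Rintegral; rewrite (_ : (\int[mu]_x (d x)%:E)%E = 0%E)//.
move/cvg_lim : lim => <- //.
by apply/cvg_lim => //; under eq_fun do rewrite int0; exact: cvg_cst.
Qed.

End translation.

(** * Balls and their moments *)

Section ball.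
Context {R : realType} {n : nat}.
Local Notation E := 'rV[R]_n.
Local Notation mu := (@lebesgue_rV R n).
Implicit Types (x y : E) (r : R).

Definition sqn x : R := \sum_i x ord0 i ^+ 2.

Lemma sqn_ge0 x : 0 <= sqn x.
Proof. by apply: sumr_ge0 => i _; exact: sqr_ge0. Qed.

Lemma sqnZ r x : sqn (r *: x) = r ^+ 2 * sqn x.
Proof. by rewrite /sqn mulr_sumr; apply: eq_bigr => i _; rewrite mxE exprMn. Qed.

Lemma sqr_fnorm p q (A : 'M[R]_(p, q)) :
  fnorm A ^+ 2 = \sum_(i < p) \sum_(j < q) A i j ^+ 2.
Proof.
rewrite /fnorm sqr_sqrtr//; apply: sumr_ge0 => i _; apply: sumr_ge0 => j _.
exact: sqr_ge0.
Qed.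

Lemma sqr_fnorm_rV x : fnorm x ^+ 2 = sqn x.
Proof. by rewrite sqr_fnorm big_ord1. Qed.

Lemma eballE r : 0 < r -> eball n r = [set x : E | sqn x < r ^+ 2].
Proof.
move=> r0; apply/seteqP; split => x /=; rewrite /eball/= -sqr_fnorm_rV;
by rewrite ltr_pXn2r ?nnegrE ?sqrtr_ge0// ltW.
Qed.

Lemma sqr_coor_le x i : x ord0 i ^+ 2 <= sqn x.
Proof. by rewrite /sqn (bigD1 i)//= lerDl sumr_ge0// => j _; exact: sqr_ge0. Qed.

Lemma coor_le r x i : 0 <= r -> sqn x <= r ^+ 2 -> `|x ord0 i| <= r.
Proof.
move=> r0 xr; rewrite -(@ler_pXn2r _ 2)// ?nnegrE// real_normK ?num_real//.
exact: le_trans (sqr_coor_le x i) xr.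
Qed.

Lemma measurable_sqn : measurable_fun setT sqn.
Proof.
apply: measurable_sum => i; apply: measurable_funX; exact: measurable_coor.
Qed.

Lemma continuous_sqn : continuous sqn.
Proof.
apply: continuous_big => [|i _]; first exact: add_continuous.
move=> x; have cx : (fun y : E => y ord0 i) @ x --> x ord0 i by exact: coord_continuous.
exact: (cvgM cx cx).
Qed.

Lemma open_eball r : 0 < r -> open (eball n r : set E).
Proof.
move=> r0; rewrite eballE//.
by move/continuousP: continuous_sqn => /(_ `]-oo, r ^+ 2[%classic); rewrite set_itvNyo; apply; exact: open_lt.
Qed.

Lemma measurable_eball r : 0 < r -> measurable (eball n r : set E).
Proof. by move=> r0; apply: open_measurable_rV; exact: open_eball. Qed.

Lemma eball_sub_box r : 0 < r -> eball n r `<=` box (const_mx (- (r + 1)) : E) (const_mx (r + 1)).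
Proof.
move=> r0 x; rewrite eballE//= => /ltW xr i; rewrite in_itv/= !mxE.
by have := coor_le i (ltW r0) xr; rewrite ler_norml => /andP[? ?]; apply/andP; split; lra.
Qed.

Lemma lebesgue_eball_lty r : 0 < r -> (mu (eball n r) < +oo)%E.
Proof.
move=> r0; apply: le_lt_trans (lebesgue_rV_box_lty (const_mx (- (r + 1))) (const_mx (r + 1))).
by apply: le_measure; rewrite ?inE//; [exact: measurable_eball|exact: measurable_box|exact: eball_sub_box].
Qed.

Lemma lebesgue_eball_scale r : 0 < r ->
  mu (eball n r) = ((r ^+ n)%:E * mu (eball n 1))%E.
Proof.
move=> r0; rewrite -(@lebesgue_rV_homothety _ _ r 0)//; last exact: measurable_eball.
congr (_ * mu _)%E; rewrite !eballE// expr1n.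
by apply/seteqP; split => x /=; rewrite /homothety addr0 sqnZ gtr_pMr// exprn_gt0.
Qed.

(** After scaling to radius 1, a cube of half-side [1/(n+1)] fits into the ball because
    [n/(n+1)^2 < 1]. *)
Lemma lebesgue_eball_gt0 r : 0 < r -> (0 < mu (eball n r))%E.
Proof.
move=> r0; rewrite lebesgue_eball_scale// mule_gt0// ?lte_fin ?exprn_gt0//.
pose e : R := n.+1%:R^-1; have e0 : 0 < e by rewrite invr_gt0.
pose A : set E := box (const_mx (- e)) (const_mx e).
have : (0 < mu A)%E.
  rewrite lebesgue_rV_box; last by move=> i; rewrite !mxE; lra.
  by rewrite lte_fin; apply: prodr_gt0 => i _; rewrite !mxE; lra.
move=> /lt_le_trans; apply; apply: le_measure; rewrite ?inE//.
- exact: measurable_box.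
- exact: measurable_eball.
rewrite eballE// => x H /=; apply: (@le_lt_trans _ _ (\sum_(i < n) e ^+ 2)).
  apply: ler_sum => i _; have := H i; rewrite in_itv/= !mxE => /andP[h1 h2].
  by rewrite -subr_ge0 subr_sqr mulr_ge0//; lra.
rewrite sumr_const card_ord expr1n -mulr_natl /e exprVn ltr_pdivrMr ?exprn_gt0// mul1r.
by rewrite -natrX ltr_nat expnS expn1; nia.
Qed.

End ball.

(** * Null spheres, and first and second moments of centred balls *)

Section moments.
Context {R : realType} {n : nat}.
Local Notation E := 'rV[R]_n.
Local Notation mu := (@lebesgue_rV R n).
Implicit Types (x y : E) (r : R).

Lemma lebesgue_eball_fin r : 0 < r -> mu (eball n r) \is a fin_num.
Proof. by move=> r0; rewrite ge0_fin_numE// lebesgue_eball_lty. Qed.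

(* The sphere lies in [eball n (c * r)] minus [eball n r] for every [c > 1]. *)
Lemma lebesgue_sphere r : 0 < r -> mu [set x | sqn x = r ^+ 2] = 0%E.
Proof.
move=> r0; set S := [set x | _].
have mS : measurable S.
  by rewrite -[S]setTI; exact: (measurable_sqn measurableT (measurable_set1 (r ^+ 2))).
have mB := @measurable_eball R n r r0.
have SB c : 1 < c -> (mu S + mu (eball n r) <= (c ^+ n)%:E * mu (eball n r))%E.
  move=> c1; have c0 : 0 < c by apply: lt_trans c1.
  rewrite -measureU//; last first.
    apply/seteqP; split => // x []; rewrite eballE// /S/= => ->.
    by rewrite ltxx.
  have -> : ((c ^+ n)%:E * mu (eball n r) = mu (eball n (c * r)))%E.
    by rewrite (lebesgue_eball_scale r0) (lebesgue_eball_scale (mulr_gt0 c0 r0)) exprMn EFinM muleA.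
  apply: le_measure; rewrite ?inE.
  - exact: measurableU.
  - by apply: measurable_eball; rewrite mulr_gt0.
  rewrite !eballE ?mulr_gt0// => x [] /=.
    move=> ->; rewrite exprMn ltr_pMl ?exprn_gt0//.
    by rewrite exprn_egt1.
  move=> /lt_le_trans; apply; rewrite exprMn ler_peMl ?exprn_ge0 ?(ltW r0)//.
  by rewrite exprn_ege1// ltW.
have Bf := lebesgue_eball_fin r0.
have Sf : mu S \is a fin_num.
  rewrite ge0_fin_numE//; apply: (@le_lt_trans _ _ (mu S + mu (eball n r))%E).
    by rewrite leeDl.
  apply: le_lt_trans (SB 2 _) _; first by lra.
  by rewrite -(fineK Bf) -EFinM ltry.
apply/eqP; rewrite eq_le measure_ge0 andbT -(fineK Sf) lee_fin.
set m := fine (mu (eball n r)); set s := fine (mu S).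
(* The choice [c = 1 + 1/(k+1)]; letting [k] tend to infinity leaves [s + m <= m]. *)
have H (k : nat) : s + m <= (1 + k.+1%:R^-1) ^+ n * m.
  have : 1 < 1 + k.+1%:R^-1 :> R by rewrite ltrDl invr_gt0.
  by move=> /SB; rewrite -(fineK Sf) -(fineK Bf) -EFinD -EFinM lee_fin.
suff : s + m <= m by lra.
have : (fun k : nat => (1 + k.+1%:R^-1) ^+ n * m) @ \oo --> (1 + 0) ^+ n * m.
  apply: cvgMr_tmp; apply: (@cvg_comp _ _ _ (fun k : nat => 1 + k.+1%:R^-1)
    (fun y : R => y ^+ n) _ (nbhs (1 + 0 : R))); last exact: exprn_continuous.
  by apply: cvgD; [exact: cvg_cst|exact: cvg_harmonic].
rewrite addr0 expr1n mul1r => /cvgr_to_ge; apply; exact: nearW.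
Qed.

Lemma coor_integrable r i : 0 < r ->
  mu.-integrable (eball n r) (EFin \o (fun x : E => x ord0 i)).
Proof.
move=> r0; apply: (integrable_EFin_bounded (measurable_eball r0) (M := r)).
- exact: lebesgue_eball_lty.
- by apply: measurable_funTS; exact: measurable_coor.
- by move=> x; rewrite eballE// => /ltW; exact: coor_le (ltW r0).
Qed.

Lemma coor2_integrable r i j : 0 < r ->
  mu.-integrable (eball n r) (EFin \o (fun x : E => x ord0 i * x ord0 j)).
Proof.
move=> r0; apply: (integrable_EFin_bounded (measurable_eball r0) (M := r * r)).
- exact: lebesgue_eball_lty.
- by apply: measurable_funTS; apply: measurable_funM; exact: measurable_coor.
- move=> x; rewrite eballE// => /ltW xr.
  by rewrite normrM ler_pM// (coor_le _ (ltW r0)).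
Qed.

(* The divergence theorem for the field [(a + b x_j) (r^2 - |x|^2) e_i], which
   vanishes on the boundary of the ball. *)
Lemma Rintegral_eball_divergence r (a b : R) (i j : 'I_n) : 0 < r ->
  \int[mu]_(x in eball n r) (b * (i == j)%:R * (r ^+ 2 - sqn x)
     - 2 * x ord0 i * (a + b * x ord0 j)) = 0.
Proof.
move=> r0.
pose q x := a + b * x ord0 j.
(* Extending [r^2 - |x|^2] by zero outside the ball makes [g] defined on the whole space, with the
   support and Lipschitz properties asked for by [Rintegral_partial0]. *)
pose p x := Num.max 0 (r ^+ 2 - sqn x).
pose g x := q x * p x.
pose D x := b * (i == j)%:R * (r ^+ 2 - sqn x) - 2 * x ord0 i * q x.
rewrite -/D Rintegral_mkcond.
have mq : measurable_fun setT q.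
  by apply: measurable_funD => //; apply: measurable_funM => //; exact: measurable_coor.
have mr : measurable_fun setT (fun x => r ^+ 2 - sqn x).
  by apply: measurable_funB => //; exact: measurable_sqn.
have mp : measurable_fun setT p by apply: measurable_maxr.
have mg : measurable_fun setT g by exact: measurable_funM.
have mB := @measurable_eball R n r r0.
have md : measurable_fun setT (D \_ (eball n r)).
  apply/(measurable_restrictT _ mB).
  apply: measurable_funTS; apply: measurable_funB; first exact: measurable_funM.
  apply: measurable_funM => //; apply: measurable_funM => //; exact: measurable_coor.
have p0 x : r ^+ 2 <= sqn x -> p x = 0 by move=> h; apply/max_idPl; rewrite subr_le0.
have p1 x : sqn x <= r ^+ 2 -> p x = r ^+ 2 - sqn x.
  by move=> h; apply/max_idPr; rewrite subr_ge0.
have pge0 x : 0 <= p x by rewrite le_max lexx.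
have pler x : p x <= r ^+ 2 by rewrite ge_max sqr_ge0 gerBl sqn_ge0.
have sqnD x h : sqn (x + h *: delta_mx ord0 i) = sqn x + 2 * h * x ord0 i + h ^+ 2.
  rewrite /sqn (bigD1 i)//= [in RHS](bigD1 i)//= !mxE !eqxx/= mulr1.
  rewrite (eq_bigr (fun k => x ord0 k ^+ 2)); first by ring.
  by move=> k ki; rewrite !mxE (negbTE ki) andbF mulr0 addr0.
have qD x h : q (x + h *: delta_mx ord0 i) = q x + b * (i == j)%:R * h.
  by rewrite /q !mxE eqxx/= eq_sym; ring.
(* If [x] or its shift by [h <= 1] lies in the ball of radius [r], then [|x| <= s]. *)
pose s := r + 1; have s0 : 0 < s by rewrite /s; lra.
have qs x : sqn x <= s ^+ 2 -> `|q x| <= `|a| + `|b| * s.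
  move=> xs; rewrite (le_trans (ler_normD _ _))// lerD2l normrM ler_wpM2l//.
  exact: coor_le (ltW s0) xs.
have gbound x : `|g x| <= (`|a| + `|b| * s) * r ^+ 2.
  have [xr|xr] := leP (sqn x) (r ^+ 2); last first.
    rewrite /g p0 ?mulr0 ?normr0 ?(ltW xr)// mulr_ge0 ?sqr_ge0//.
    by rewrite addr_ge0// mulr_ge0// ltW.
  rewrite /g normrM (ger0_norm (pge0 _)) ler_pM// qs// (le_trans xr)//.
  by rewrite /s; nra.
have gr x k : r < `|x ord0 k| -> g x = 0.
  move=> rx; rewrite /g p0 ?mulr0//; apply: le_trans (sqr_coor_le x k).
  by rewrite -[leRHS]real_normK ?num_real//; nra.
have [] := @Rintegral_partial0 R n i g (D \_ (eball n r)) r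
  (`|b| * r ^+ 2 + (`|a| + `|b| * s) * (2 * s + 1)) (ltW r0) mg md.
- apply: (@integrable_rV_bounded_support _ _ (const_mx (- (r + 1))) (const_mx (r + 1))) gbound _ => //.
  move=> x /existsNP[k /negP]; rewrite in_itv/= !mxE negb_and -leNgt -ltNge => xk.
  apply: (gr _ k); case/orP: xk => xk; rewrite ltr_normr; first by apply/orP; right; lra.
  by apply/orP; left; lra.
- exact: gr.
- move=> x h /andP[h0 h1]; set y := x + _.
  have rhs0 : 0 <= (`|b| * r ^+ 2 + (`|a| + `|b| * s) * (2 * s + 1)) * h.
    have := normr_ge0 a; have := normr_ge0 b => ? ?.
    by rewrite mulr_ge0// addr_ge0// mulr_ge0// ?sqr_ge0//; [nra|lra].
  have [/orP in_ball|] := boolP ((sqn x < r ^+ 2) || (sqn y < r ^+ 2)); last first.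
    by rewrite negb_or -!leNgt => /andP[xr yr]; rewrite /g (p0 _ xr) (p0 _ yr) !mulr0 subrr normr0.
  have yE : sqn y = sqn x + 2 * h * x ord0 i + h ^+ 2 by exact: sqnD.
  have xs : sqn x <= s ^+ 2.
    case: in_ball => [xr|yr]; first by rewrite /s; nra.
    have := coor_le i (ltW r0) (ltW yr); rewrite /y !mxE !eqxx/= mulr1 ler_norml => /andP[y1 y2].
    by rewrite /s; nra.
  have := coor_le i (ltW s0) xs; rewrite ler_norml => /andP[x1 x2].
  have pyx : `|p y - p x| <= (2 * s + 1) * h.
    (* The positive part is 1-Lipschitz. *)
    apply: (@le_trans _ _ `|sqn y - sqn x|).
      have D1 := ler_norm (sqn y - sqn x); have := ler_norm (- (sqn y - sqn x)).
      rewrite normrN ler_norml /p; move: D1; set N := `|_| => D1 D2.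
      by case: (lerP 0 (r ^+ 2 - sqn y)) => ?; case: (lerP 0 (r ^+ 2 - sqn x)) => ?; apply/andP; split; lra.
    by rewrite yE ler_norml; apply/andP; split; nra.
  rewrite /g qD -/y.
  have -> : (q x + b * (i == j)%:R * h) * p y - q x * p x =
    b * (i == j)%:R * h * p y + q x * (p y - p x) by ring.
  rewrite (le_trans (ler_normD _ _))// [leRHS]mulrDl lerD//.
    rewrite !normrM (ger0_norm h0) (ger0_norm (pge0 y)).
    rewrite -[leRHS]mulrA [r ^+ 2 * h]mulrC mulrA ler_pM// ?mulr_ge0// ler_wpM2r//.
    by case: (i == j); rewrite ?normr1 ?normr0 ?mulr1 ?mulr0.
  by rewrite normrM -mulrA ler_pM// qs.
(* The difference quotients may fail to converge to the claimed derivative only on the sphere, which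
   is a null set. *)
- have mS : measurable [set x : E | sqn x = r ^+ 2].
    by rewrite -[X in measurable X]setTI; exact: (measurable_sqn measurableT (measurable_set1 (r ^+ 2))).
  exists [set x | sqn x = r ^+ 2]; split=> //; first exact: lebesgue_sphere.
  move=> x /=; apply: contra_notP => /eqP xr.
  pose h (k : nat) : R := k.+1%:R^-1.
  have h_cvg0 : h @ \oo --> 0 by exact: cvg_harmonic.
  have hx : (fun k => sqn (x + h k *: delta_mx ord0 i)) @ \oo --> sqn x.
    suff : (fun k => sqn (x + h k *: delta_mx ord0 i)) @ \oo -->
        sqn x + 2 * x ord0 i * 0 + 0 * 0 by rewrite !mulr0 !addr0.
    under eq_fun do rewrite sqnD mulrAC.
    apply: cvgD; last exact: (cvgM h_cvg0 h_cvg0).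
    by apply: cvgD; [exact: cvg_cst|exact: cvgMl_tmp].
  have [xr1|xr1|xr1] := ltgtP (sqn x) (r ^+ 2); last 2 first.
  + rewrite patchE memNset; last by rewrite eballE//= => /(lt_trans xr1); rewrite ltxx.
    apply: cvg_near_cst; have : \forall k \near \oo, r ^+ 2 < sqn (x + h k *: delta_mx ord0 i).
      exact: (cvgr_gt _ hx).
    by apply: filterS => k yk; rewrite /g !p0 ?mulr0 ?subrr ?mulr0// ltW.
  + by rewrite xr1 eqxx in xr.
  rewrite patchE mem_set; last by rewrite eballE.
  (* For [k] so large that the shifted point is also in the ball, the difference quotient of [g]
     equals this expression exactly. *)
  have lim : (fun k => b * (i == j)%:R * (r ^+ 2 - sqn (x + h k *: delta_mx ord0 i))
      - (2 * x ord0 i + h k) * q x) @ \oo --> D x.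
    rewrite /D -[X in _ - X * _]addr0; apply: cvgB.
      by apply: cvgMl_tmp; apply: cvgB => //; exact: cvg_cst.
    by apply: cvgMr_tmp; apply: cvgD => //; exact: cvg_cst.
  apply: cvg_trans lim; apply: near_eq_cvg.
  have : \forall k \near \oo, sqn (x + h k *: delta_mx ord0 i) < r ^+ 2.
    exact: (cvgr_lt _ hx).
  apply: filterS => k yk; rewrite /g !p1 ?(ltW xr1) ?(ltW yk)// qD sqnD.
  have hk : k.+1%:R * h k = 1 :> R by rewrite mulfV.
  rewrite -/(h k); transitivity (k.+1%:R * h k * (b * (i == j)%:R * (r ^+ 2 -
   (sqn x + 2 * h k * x ord0 i + h k ^+ 2)) - (2 * x ord0 i + h k) * q x)).
    by rewrite hk mul1r.
  by ring.
- by [].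
Qed.

(** The choice [a = 1], [b = 0] reduces the divergence identity to [-2] times this integral. *)
Lemma Rintegral_coor r i : 0 < r -> \int[mu]_(x in eball n r) x ord0 i = 0.
Proof.
move=> r0; have := Rintegral_eball_divergence 1 0 i i r0.
under eq_Rintegral do rewrite !mul0r add0r addr0 mulr1 -mulNr.
rewrite RintegralZl//; [|exact: measurable_eball|exact: coor_integrable].
by move/eqP; rewrite mulf_eq0 oppr_eq0 pnatr_eq0/= => /eqP.
Qed.

Lemma center_of_mass_eball r : 0 < r -> center_of_mass (eball n r : set E) = 0.
Proof.
by move=> r0; apply/rowP => i; rewrite !mxE /average Rintegral_coor// mulr0.
Qed.

(** For [a = 0], [b = 1] the divergence identity reads [(k == l) (m - S) = 2 M k l], where [S] is
    the integral of [|x|^2]. Summing over the diagonal gives [2 S = n (m - S)], hence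
    [m - S = 2 m / (n + 2)]. *)
Lemma Rintegral_coor2 (i j : 'I_n) : \int[mu]_(x in eball n 1) (x ord0 i * x ord0 j) =
  (i == j)%:R * (fine (mu (eball n 1)) / (n%:R + 2)).
Proof.
pose M i j := \int[mu]_(x in eball n 1) (x ord0 i * x ord0 j).
pose m := fine (mu (eball n 1)).
pose S := \int[mu]_(x in eball n 1) sqn x.
have mB := @measurable_eball R n 1 ltr01.
have Si : mu.-integrable (eball n 1) (EFin \o sqn).
  by apply: integrable_EFin_sum => // k; exact: coor2_integrable.
have SE : S = \sum_k M k k by rewrite /S Rintegral_sumr// => k; exact: coor2_integrable.
have ci (c : R) : mu.-integrable (eball n 1) (EFin \o (fun x : E => c)).
  apply: (integrable_EFin_bounded mB (M := `|c|)) => //; exact: lebesgue_eball_lty.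
have key k l : (k == l)%:R * (m - S) = 2 * M k l.
  have := Rintegral_eball_divergence 0 1 k l (@ltr01 R).
  under eq_Rintegral do rewrite !mul1r add0r expr1n -mulrA.
  rewrite RintegralB//; last 2 first.
  - by apply: integrable_EFinZ => //; exact: integrable_EFinB.
  - by apply: integrable_EFinZ => //; exact: coor2_integrable.
  rewrite !RintegralZl//; last 2 first.
  - exact: coor2_integrable.
  - exact: integrable_EFinB.
  rewrite RintegralB// Rintegral_cst// mul1r -/S -/m -/(M k l).
  by move/eqP; rewrite subr_eq0 => /eqP.
have S1 : 2 * S = n%:R * (m - S).
  rewrite SE mulr_sumr -SE (eq_bigr (fun=> m - S)); last first.
    by move=> k _; rewrite -key eqxx mul1r.
  by rewrite sumr_const card_ord mulr_natl.
have n2 : n%:R + 2 != 0 :> R by rewrite gt_eqF// ltr_wpDl.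
have mS : m - S = 2 * (m / (n%:R + 2)).
  apply: (mulIf n2); rewrite -mulrA divfK//; move: S1; lra.
by apply: (@mulfI _ 2) => //; rewrite -/(M i j) -key mS mulrCA.
Qed.

End moments.

(** * Smooth functions built from exp(-1/t) *)

Section flat.
Context {R : realType}.
Implicit Types (m : nat) (t : R).

(** The powers of [1/t] are included because differentiating [exp(-1/t)] produces them. *)
Definition flat m t : R := if 0 < t then t^-1 ^+ m * expR (- t^-1) else 0.

Lemma flat_ge0 m t : 0 <= flat m t.
Proof.
rewrite /flat; case: ifPn => // t0.
by rewrite mulr_ge0 ?expR_ge0// exprn_ge0// invr_ge0 ltW.
Qed.

Lemma flat_le0 m t : t <= 0 -> flat m t = 0.
Proof. by rewrite /flat leNgt => /negbTE ->. Qed.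

Lemma flat0_gt0 t : 0 < t -> 0 < flat 0 t.
Proof. by rewrite /flat => ->; rewrite expr0 mul1r expR_gt0. Qed.

Lemma flat0_le1 t : flat 0 t <= 1.
Proof.
rewrite /flat; case: ifPn => // t0.
by rewrite expr0 mul1r -expR0 ler_expR oppr_le0 invr_ge0 ltW.
Qed.

(** With [s = 1/t], raising [exp(s/(m+1)) >= s/(m+1)] to the power [m+1] bounds [exp(s)] below by a
    multiple of [s^(m+1)], one power more than [s^m]. *)
Lemma flat_linear_bound m t : 0 < t -> flat m t <= m.+1%:R ^+ m.+1 * t.
Proof.
move=> t0; rewrite /flat t0 expRN.
have e0 : 0 < expR t^-1 by exact: expR_gt0.
have tm : 0 < t^-1 ^+ m by rewrite exprn_gt0// invr_gt0.
rewrite ler_pdivrMr//.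
have : (t^-1 / m.+1%:R) ^+ m.+1 <= expR t^-1.
  rewrite -[leRHS](_ : expR (t^-1 / m.+1%:R) ^+ m.+1 = _); last first.
    by rewrite -expRM_natl mulrC divfK.
  rewrite lerXn2r ?nnegrE ?divr_ge0 ?invr_ge0 ?expR_ge0 ?(ltW t0)//.
  by apply: le_trans (expR_ge1Dx _); rewrite lerDr.
move=> h; rewrite -mulrA; apply: le_trans (_ : m.+1%:R ^+ m.+1 * (t * (t^-1 / m.+1%:R) ^+ m.+1) <= _).
  set K : R := m.+1%:R; have K0 : K ^+ m.+1 != 0 by rewrite expf_neq0 ?pnatr_eq0.
  rewrite exprMn [K^-1 ^+ _]exprVn [t^-1 ^+ m.+1]exprS le_eqVlt; apply/orP; left; apply/eqP.
  by move: (t^-1 ^+ m) K0 => w; move: (K ^+ _) => z z0; field; rewrite z0 gt_eqF.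
by rewrite ler_wpM2l ?exprn_ge0// ler_wpM2l// ltW.
Qed.

(** Away from 0 the function coincides locally with a formula; at 0 the difference quotient is
    squeezed to 0. *)
Lemma is_derive_flat m t :
  is_derive t 1 (flat m) (flat m.+2 t - m%:R * flat m.+1 t).
Proof.
have [t0|t0|t0] := ltgtP 0 t.
- pose f (s : R) := s^-1 ^+ m * expR (- s^-1).
  apply: (@near_eq_is_derive _ _ _ f).
    by near=> s; rewrite /flat (_ : 0 < s)//; near: s; exact: lt_nbhsr.
  have dV : is_derive t 1 (fun s : R => s^-1) (- t ^- 2).
    have := @is_deriveV R id t 1 1; rewrite gt_eqF// => /(_ isT (is_derive_id _ _)).
    by rewrite [_ *: _]mulr1.
  have dVm := is_deriveX m dV; rewrite exprfctE in dVm.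
  have dE : is_derive t 1 (expR \o (fun s : R => - s^-1)) (expR (- t^-1) * t ^- 2).
    apply: is_derive1_comp; rewrite -[t ^- 2]opprK; exact: is_deriveN dV.
  apply: (is_derive_eq (is_deriveM dVm dE)).
  rewrite /flat t0 /=; case: m @f dVm => [|m] _ _.
    by rewrite !mul0r !scale0r scaler0 addr0 expr0 scale1r subr0 mulrC exprVn.
  rewrite -![_ *: _]/(_ * _) /= -exprVn !exprS.
  by move: (t^-1 ^+ m) (m.+1%:R : R) (expR (- t^-1)) (t^-1) => w k e z; ring.
- apply: (@near_eq_is_derive _ _ _ (cst 0)).
    by near=> s; rewrite flat_le0 ?ltW//; near: s; exact: lt_nbhsl.
  by rewrite !flat_le0 ?(ltW t0)// mulr0 subr0; exact: is_derive_cst.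
rewrite -t0 !flat_le0// mulr0 subr0.
have H : (fun h : R => h^-1 *: ((flat m \o shift 0) (h *: 1) - flat m 0)) @ 0^' --> (0 : R).
  (* For [h > 0], dividing by [h] turns [flat m h] into [flat m.+1 h]; the constant is that of
     [flat_linear_bound] at [m.+1]. *)
  apply: (@squeeze_cvgr _ _ _ _ (fun=> 0) (fun h : R => m.+2%:R ^+ m.+2 * `|h|)).
  - near=> h; rewrite (flat_le0 _ (lexx 0)) subr0 /= addr0 [h *: 1]mulr1 -[_ *: flat m h]/(h^-1 * flat m h).
    have [h0|h0] := ltP 0 h; last by rewrite flat_le0// mulr0 lexx mulr_ge0 ?exprn_ge0.
    have -> : h^-1 * flat m h = flat m.+1 h by rewrite /flat h0 exprS mulrA.
    by rewrite flat_ge0 (ger0_norm (ltW h0)) flat_linear_bound.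
  - exact: cvg_cst.
  - have : (fun h : R => `|h|) @ (0 : R)^' --> (0 : R).
      apply: cvg_within_filter.
      by have := @norm_continuous _ R (0 : R); rewrite /continuous_at normr0.
    by move=> /(@cvgMl_tmp _ _ _ _ _ (m.+2%:R ^+ m.+2)); rewrite mulr0.
by apply: DeriveDef; [apply/cvg_ex; exists 0|exact/cvg_lim].
Unshelve. all: by end_near. Qed.

Lemma continuous_flat m : continuous (flat m).
Proof.
move=> t; apply/differentiable_continuous/derivable1_diffP.
by have [] := is_derive_flat m t.
Qed.

End flat.

(** * Directional derivatives *)

Section directional.
Context {R : realType} {V : normedModType R}.
Implicit Types (f : V -> R) (x v : V).

(** The two difference quotients are the same function, so the one-variable chain rule and mean
    value theorem carry over to directional derivatives. *)
Lemma is_derive_line f x v df (s : R) :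
  is_derive (s *: v + x) v f df <-> is_derive s 1 (fun t : R => f (t *: v + x)) df.
Proof.
have E : (fun h : R => h^-1 *: ((f \o shift (s *: v + x)) (h *: v) - f (s *: v + x))) =
  (fun h : R => h^-1 *: (((fun t : R => f (t *: v + x)) \o shift s) (h *: 1) -
     (fun t : R => f (t *: v + x)) s)).
  by apply/funext => h /=; rewrite [h *: 1]mulr1 scalerDl addrA.
have E1 : derivable f (s *: v + x) v = derivable (fun t : R => f (t *: v + x)) s 1.
  by rewrite /derivable E.
have E2 : 'D_v f (s *: v + x) = 'D_1 (fun t : R => f (t *: v + x)) s.
  by rewrite /derive E.
by split=> -[dv dd]; apply: DeriveDef; [rewrite -E1|rewrite -E2|rewrite E1|rewrite E2].
Qed.

Lemma is_derive_comp f (phi : R -> R) x v df dphi :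
  is_derive x v f df -> is_derive (f x) 1 phi dphi ->
  is_derive x v (phi \o f) (dphi * df).
Proof.
have x0 : x = (0 : R) *: v + x by rewrite scale0r add0r.
move=> fx phix; rewrite x0 in fx phix *.
apply/is_derive_line; move/is_derive_line : fx => fx.
exact: (is_derive1_comp phix fx).
Qed.

(** The mean value theorem on the segment from [x] to [x + h *: v]. *)
Lemma is_derive_lipschitz f v (df : V -> R) (L : R) :
  (forall x, is_derive x v f (df x)) -> (forall x, `|df x| <= L) ->
  forall x h, 0 <= h -> `|f (x + h *: v) - f x| <= L * h.
Proof.
move=> fd dL x h; rewrite le_eqVlt => /predU1P[<-|h0].
  by rewrite scale0r addr0 subrr normr0 mulr0.
pose F (t : R) := f (t *: v + x).
have Fd (t : R) : is_derive t 1 F (df (t *: v + x)) by exact/is_derive_line.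
have [|c _] := @MVT R F (fun t => df (t *: v + x)) 0 h h0 (fun t _ => Fd t).
  by apply: derivable_within_continuous => t _; have [] := Fd t.
rewrite /F scale0r add0r subr0 [x + _]addrC => ->.
by rewrite normrM (ger0_norm (ltW h0)) ler_wpM2r// ltW.
Qed.

(** The sequential form of the derivative that [Rintegral_partial0] takes as a hypothesis. *)
Lemma is_derive_cvg f x v df : is_derive x v f df ->
  (fun k => k.+1%:R * (f (x + k.+1%:R^-1 *: v) - f x)) @ \oo --> df.
Proof.
move=> [dv <-].
have h0 : (fun k : nat => k.+1%:R^-1 : R) @ \oo --> (0 : R)^'.
  move=> A [e /= e0 eA].
  have : \forall k \near \oo, `|0 - k.+1%:R^-1 : R| < e.
    by have /cvgrPdist_lt := @cvg_harmonic R; exact.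
  apply: filterS => k ke; apply: eA; first by rewrite /ball_/=.
  by rewrite invr_eq0.
have := cvg_comp _ _ h0 dv; apply: cvg_trans; apply: near_eq_cvg; apply: nearW => k /=.
by rewrite invrK [_ *: v + x]addrC.
Qed.

End directional.

(** * A class of explicit smooth functions *)

Section elementary.
Context {R : realType} {n : nat}.
Local Notation E := 'rV[R]_n.

Inductive elementary : (E -> R) -> Prop :=
| elementary_cst c : elementary (fun=> c)
| elementary_coor i : elementary (fun x => x ord0 i)
| elementaryD f g : elementary f -> elementary g -> elementary (fun x => f x + g x)
| elementaryM f g : elementary f -> elementary g -> elementary (fun x => f x * g x)
| elementary_flat m f : elementary f -> elementary (fun x => flat m (f x)).

Lemma elementary_continuous f : elementary f -> continuous f.
Proof.
elim=> {f}.
- by move=> c; exact: cst_continuous.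
- by move=> i x; exact: coord_continuous.
- by move=> f g _ cf _ cg x; exact: (cvgD (cf x) (cg x)).
- by move=> f g _ cf _ cg x; exact: (cvgM (cf x) (cg x)).
- move=> m f _ cf x; apply: (cvg_comp _ _ (cf x)); exact: continuous_flat.
Qed.

Lemma is_derive_coor (x v : E) (i : 'I_n) :
  is_derive x v (fun y : E => y ord0 i) (v ord0 i).
Proof.
have H : (fun h : R => h^-1 *: (((fun y : E => y ord0 i) \o shift x) (h *: v) - x ord0 i)) @ 0^'
    --> v ord0 i.
  apply: cvg_near_cst; near=> h; rewrite /= !mxE addrK [_ *: _]mulrA mulVf ?mul1r//.
  near: h; exact: nbhs_dnbhs_neq.
by apply: DeriveDef; [apply/cvg_ex; exists (v ord0 i)|exact/cvg_lim].
Unshelve. all: by end_near. Qed.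

Lemma elementary_derive f i : elementary f ->
  exists2 df, elementary df & forall x, is_derive x (delta_mx ord0 i : E) f (df x).
Proof.
elim=> {f}.
- by move=> c; exists (fun=> 0); [exact: elementary_cst|move=> x; exact: is_derive_cst].
- move=> j; exists (fun=> (delta_mx ord0 i : E) ord0 j); first exact: elementary_cst.
  by move=> x; exact: is_derive_coor.
- move=> f g ef [df edf fd] eg [dg edg gd].
  exists (fun x => df x + dg x); first exact: elementaryD.
  by move=> x; exact: is_deriveD.
- move=> f g ef [df edf fd] eg [dg edg gd].
  exists (fun x => f x * dg x + g x * df x).
    by apply: elementaryD; exact: elementaryM.
  by move=> x; exact: is_deriveM.
- move=> m f ef [df edf fd].
  exists (fun x => (flat m.+2 (f x) + (- m%:R) * flat m.+1 (f x)) * df x).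
    apply: elementaryM => //; apply: elementaryD; first exact: elementary_flat.
    by apply: elementaryM; [exact: elementary_cst|exact: elementary_flat].
  by move=> x; apply: is_derive_comp => //; rewrite mulNr; exact: is_derive_flat.
Qed.

(** Every iterated partial derivative is again elementary, hence continuous and derivable. *)
Lemma elementary_smooth f : elementary f -> smooth f.
Proof.
move=> ef s.
have {ef} : elementary (partials s f).
  elim: s => //= i s IH; have [df edf fd] := elementary_derive i IH.
  by rewrite /partial (_ : 'D_ _ _ = df)//; apply/funext => x; have [_ <-] := fd x.
move=> es; split; first exact: elementary_continuous.
by move=> i x; have [df _ /(_ x)[]] := elementary_derive i es.
Qed.

Lemma elementary_sum I (s : seq I) (f : I -> E -> R) : (forall i, elementary (f i)) ->
  elementary (fun x => \sum_(i <- s) f i x).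
Proof.
move=> ef; elim: s => [|i s IH].
  by under eq_fun do rewrite big_nil; exact: elementary_cst.
by under eq_fun do rewrite big_cons; exact: elementaryD.
Qed.

Lemma elementary_prod I (s : seq I) (f : I -> E -> R) : (forall i, elementary (f i)) ->
  elementary (fun x => \prod_(i <- s) f i x).
Proof.
move=> ef; elim: s => [|i s IH].
  by under eq_fun do rewrite big_nil; exact: elementary_cst.
by under eq_fun do rewrite big_cons; exact: elementaryM.
Qed.

End elementary.

(** * Weak derivatives *)

Section test_functions.
Context {R : realType} {n : nat}.
Local Notation E := 'rV[R]_n.
Local Notation mu := (@lebesgue_rV R n).
Implicit Types (Omega K : set E) (u v w f phi : E -> R).

Definition supported K f := forall x, ~ K x -> f x = 0.

Lemma supported_bounded K f : compact K -> continuous f -> supported K f ->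
  exists M : R, forall x, `|f x| <= M.
Proof.
move=> cK cf f0.
have /compact_bounded [M [_ HM]] : compact (f @` K).
  by apply: continuous_compact => //; exact: continuous_subspaceT.
exists (Num.max 0 (M + 1)) => x; have [Kx|/f0 ->] := pselect (K x).
  rewrite le_max; apply/orP; right; apply: (HM (M + 1)); first by rewrite ltrDl.
  by exists x.
by rewrite normr0 le_max lexx.
Qed.

Definition support phi : set E := closure [set x | phi x != 0].

Lemma support_supported phi : supported (support phi) phi.
Proof.
by move=> x Kx; apply: contra_notP Kx => /eqP px; exact: subset_closure.
Qed.

(** The complement of the support is open, so [phi] is locally zero at each of its points. *)
Lemma supported_partial i phi : supported (support phi) (partial i phi).
Proof.
move=> x Kx; rewrite /partial.
have : nbhs x (~` support phi).
  by apply: open_nbhs_nbhs; split => //; exact/closed_openC/closed_closure.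
move=> H; rewrite (@near_eq_derive _ _ _ _ (cst 0)) ?derive_cst//.
by apply: filterS H => y /support_supported.
Qed.

Lemma test_function_continuous Omega phi : test_function Omega phi -> continuous phi.
Proof. by case=> /(_ [::])[]. Qed.

Lemma test_function_partial Omega i phi : test_function Omega phi ->
  continuous (partial i phi).
Proof. by case=> /(_ [:: i])[]. Qed.

Lemma test_function_is_derive Omega i phi x : test_function Omega phi ->
  is_derive x (delta_mx ord0 i : E) phi (partial i phi x).
Proof. by case=> /(_ [::])[_ /(_ i x) d] _ _; exact: DeriveDef. Qed.

Lemma supportedM K f phi : supported K phi -> supported K (fun x => f x * phi x).
Proof. by move=> p0 x /p0 ->; rewrite mulr0. Qed.

(** By compactness [f] is bounded, so on [K] the product is dominated by a multiple of [|v|]; off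
    [K] it is zero. *)
Lemma locally_integrable_mul Omega K v f : measurable Omega ->
  Defs.locally_integrable Omega v -> compact K -> K `<=` Omega ->
  continuous f -> supported K f ->
  mu.-integrable Omega (EFin \o (fun x => v x * f x)).
Proof.
move=> mO [mv vi] cK KO cf f0; have mK := compact_measurable_rV cK.
have [M fM] := supported_bounded cK cf f0.
have mf : measurable_fun setT f by exact: continuous_measurable_rV.
have vK : mu.-integrable K (EFin \o (fun x => v x * f x)).
  have vKi := vi K cK KO.
  apply: (le_integrable_EFin mK (g := fun x => M * `|v x|)).
  - apply: measurable_funM; last exact: measurable_funTS.
    exact: measurable_funS mv.
  - by move=> x Kx; rewrite normrM mulrC ler_wpM2r.
  - by apply: integrable_EFinZ => //; exact: integrable_norm vKi.
have : mu.-integrable (Omega `&` K) (EFin \o (fun x => v x * f x)).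
  by rewrite (setIidr KO).
move=> /(integrable_restrict _ mK mO); apply: eq_integrable => // x _.
rewrite patchE; case: ifPn => // /negP; rewrite inE => /f0 /=.
by move=> ->; rewrite mulr0.
Qed.

Lemma test_mul_integrable Omega v phi : measurable Omega ->
  Defs.locally_integrable Omega v -> test_function Omega phi ->
  mu.-integrable Omega (EFin \o (fun x => v x * phi x)).
Proof.
move=> mO vl tphi; have [_ cK KO] := tphi.
apply: (locally_integrable_mul mO vl cK KO); first exact: (test_function_continuous tphi).
exact: support_supported.
Qed.

Lemma test_mul_partial_integrable Omega i v phi : measurable Omega ->
  Defs.locally_integrable Omega v -> test_function Omega phi ->
  mu.-integrable Omega (EFin \o (fun x => v x * partial i phi x)).
Proof.
move=> mO vl tphi; have [_ cK KO] := tphi.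
apply: (locally_integrable_mul mO vl cK KO); first exact: (@test_function_partial Omega i phi tphi).
exact: supported_partial.
Qed.

Lemma locally_integrableDZ Omega u v (c : R) : measurable Omega ->
  Defs.locally_integrable Omega u -> Defs.locally_integrable Omega v ->
  Defs.locally_integrable Omega (fun x => u x + c * v x).
Proof.
move=> mO [mu_ ui] [mv vi]; split.
  by apply: measurable_funD => //; exact: measurable_funM.
move=> K cK KO; have mK := compact_measurable_rV cK.
by apply: integrable_EFinD => //; [exact: ui|apply: integrable_EFinZ => //; exact: vi].
Qed.

Lemma is_weak_partialDZ Omega i u v u' v' (c : R) : measurable Omega ->
  is_weak_partial Omega i u v -> is_weak_partial Omega i u' v' ->
  is_weak_partial Omega i (fun x => u x + c * u' x) (fun x => v x + c * v' x).
Proof.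
move=> mO [lu lv uv] [lu' lv' uv']; split; [exact: locally_integrableDZ..|].
move=> phi tphi.
have lin p q : Defs.locally_integrable Omega p -> Defs.locally_integrable Omega q ->
    forall g, mu.-integrable Omega (EFin \o (fun x => p x * g x)) ->
     mu.-integrable Omega (EFin \o (fun x => q x * g x)) ->
   \int[mu]_(x in Omega) ((p x + c * q x) * g x) =
   \int[mu]_(x in Omega) (p x * g x) + c * \int[mu]_(x in Omega) (q x * g x).
  move=> lp lq g pg qg; under eq_Rintegral do rewrite mulrDl -mulrA.
  by rewrite RintegralD ?RintegralZl//; exact: integrable_EFinZ.
rewrite !lin//; do ?[exact: test_mul_integrable|exact: test_mul_partial_integrable].
by rewrite uv// uv'// opprD mulrN.
Qed.

Lemma ae_eq_locally_integrable Omega u u' : measurable Omega ->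
  measurable_fun Omega u' -> ae_eq mu Omega u u' ->
  Defs.locally_integrable Omega u -> Defs.locally_integrable Omega u'.
Proof.
move=> mO mu' uu' [mu_ ui]; split=> // K cK KO; have mK := compact_measurable_rV cK.
apply: (ae_eq_integrable mK _ _ _ (ui K cK KO)).
- exact: measurable_funS mu_.
- exact: measurable_funS mu'.
- by apply: filterS uu' => x H /KO.
Qed.

(** Permits replacing one representative by another, which is needed because [weak_partial] selects
    an unspecified one. *)
Lemma ae_eq_is_weak_partial Omega i u u' v v' : measurable Omega ->
  measurable_fun Omega u' -> ae_eq mu Omega u u' ->
  measurable_fun Omega v' -> ae_eq mu Omega v v' ->
  is_weak_partial Omega i u v -> is_weak_partial Omega i u' v'.
Proof.
move=> mO mu' uu' mv' vv' [lu lv uv].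
split; [exact: ae_eq_locally_integrable uu' lu|exact: ae_eq_locally_integrable vv' lv|].
move=> phi tphi.
have mphi : measurable_fun Omega phi.
  by apply: measurable_funTS; apply: continuous_measurable_rV; exact: (test_function_continuous tphi).
have mdphi : measurable_fun Omega (partial i phi).
  by apply: measurable_funTS; apply: continuous_measurable_rV; exact: (@test_function_partial Omega i phi tphi).
have := uv _ tphi.
rewrite (@ae_eq_Rintegral _ _ _ mu _ mO (fun x => u x * partial i phi x) (fun x => u' x * partial i phi x)).
- rewrite (@ae_eq_Rintegral _ _ _ mu _ mO (fun x => v x * phi x) (fun x => v' x * phi x))//.
  + by apply: measurable_funM => //; case: lv.
  + exact: measurable_funM.
  + by apply: filterS vv' => x H /H ->.
- by apply: measurable_funM => //; case: lu.
- exact: measurable_funM.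
- by apply: filterS uu' => x H /H ->.
Qed.

End test_functions.

(** * The fundamental lemma of the calculus of variations on the unit ball *)

Section fundamental_lemma.
Context {R : realType} {n : nat}.
Local Notation E := 'rV[R]_n.
Local Notation mu := (@lebesgue_rV R n).
Local Notation B := (eball n (1 : R)).
Implicit Types (u v w f phi : E -> R).

Let mB : measurable B. Proof. exact: measurable_eball. Qed.

Lemma supported_test_function (Omega K : set E) phi : elementary phi -> compact K ->
  K `<=` Omega -> supported K phi -> test_function Omega phi.
Proof.
move=> ephi cK KO phi0.
have cl : support phi `<=` K.
  have <- : closure K = K.
    have : closed K by move: (cK) => /compact_closed; apply; exact: norm_hausdorff.
    by move=> /closure_id.
  by apply: closure_subset => x /= px; apply: contrapT => /phi0 p0; rewrite p0 eqxx in px.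
split; first exact: elementary_smooth.
- by apply: subclosed_compact cl => //; exact: closed_closure.
- exact: subset_trans cl KO.
Qed.

Definition cball (r : R) : set E := [set x | sqn x <= r ^+ 2].

(** Heine-Borel: [coor_le] bounds the sup norm, and the set is the preimage of a closed interval
    under [sqn]. *)
Lemma compact_cball r : 0 <= r -> compact (cball r).
Proof.
move=> r0; apply: bounded_closed_compact.
  exists r; split; first exact: num_real.
  move=> y ry x /= xr; have y0 : 0 <= y by apply: le_trans r0 (ltW ry).
  rewrite /Num.norm/= mx_normrE; apply: bigmax_le => // -[a b] _ /=.
  rewrite (_ : a = ord0); last exact: ord1.
  exact: le_trans (coor_le b r0 xr) (ltW ry).
have -> : cball r = sqn @^-1` `]-oo, r ^+ 2]%classic.
  by apply/seteqP; split => x /=; rewrite in_itv.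
apply: closed_comp => [x _|]; first exact: continuous_sqn.
exact: interval_closed.
Qed.

Lemma cball_sub_eball r : 0 <= r < 1 -> cball r `<=` B.
Proof.
move=> /andP[r0 r1] x /= xr; rewrite eballE//= expr1n (le_lt_trans xr)//.
by rewrite expr_lt1.
Qed.

(** For [t > 0] the values [exp(-1/((k+1) t))] tend to 1, and otherwise all terms are 0: dilations
    of [flat 0] approximate the indicator of the open half-line. *)
Lemma cvg_flat0_scale (t : R) :
  (fun k : nat => flat 0 (k.+1%:R * t)) @ \oo --> ((0 < t)%R%:R : R).
Proof.
have [t0|t0] := ltP 0 t; last first.
  apply: cvg_near_cst; apply: nearW => k; rewrite flat_le0//.
  by rewrite mulr_ge0_le0.
have H : (fun k : nat => expR (- (k.+1%:R^-1 * t^-1))) @ \oo --> expR (- (0 * t^-1)).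
  apply: (@cvg_comp _ _ _ (fun k : nat => - (k.+1%:R^-1 * t^-1)) expR _ (nbhs (- (0 * t^-1)))).
    by apply: cvgN; apply: cvgMr_tmp; exact: cvg_harmonic.
  exact: continuous_expR.
rewrite mul0r oppr0 expR0 in H; apply: cvg_trans H; apply: near_eq_cvg.
by apply: nearW => k /=; rewrite /flat mulr_gt0// expr0 mul1r invfM.
Qed.

(** Smooth, and positive exactly where [|x|^2 < r^2]. Multiplication by it turns elementary
    functions without compact support into test functions. *)
Definition cutoff (r : R) (x : E) : R := flat 0 (r ^+ 2 - sqn x).

Lemma elementary_cutoff r : elementary (cutoff r).
Proof.
apply: elementary_flat; rewrite /sqn.
under eq_fun do rewrite -mulN1r.
apply: elementaryD; first exact: elementary_cst.
apply: elementaryM; first exact: elementary_cst.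
apply: elementary_sum => i; under eq_fun do rewrite expr2.
by apply: elementaryM; exact: elementary_coor.
Qed.

Lemma supported_cutoff r : supported (cball r) (cutoff r).
Proof.
move=> x /negP; rewrite /cutoff -ltNge => /ltW xr; apply: flat_le0.
by rewrite subr_le0.
Qed.

(** In direction [i] the factor tends to the indicator of [x_i > a_i] times that of [x_i <= b_i], so
    the limit is the indicator of the half-open box at every point, its boundary included. *)
Definition box_bump (a b : E) (k : nat) (x : E) : R :=
  \prod_(i < n) (flat 0 (k.+1%:R * (x ord0 i - a ord0 i)) *
    (1 - flat 0 (k.+1%:R * (x ord0 i - b ord0 i)))).

Lemma elementary_box_bump a b k : elementary (box_bump a b k).
Proof.
have aff (c : R) i : elementary (fun x : E => flat 0 (k.+1%:R * (x ord0 i - c))).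
  apply: elementary_flat; apply: elementaryM; first exact: elementary_cst.
  by apply: elementaryD; [exact: elementary_coor|exact: elementary_cst].
apply: elementary_prod => i; apply: elementaryM; first exact: aff.
under eq_fun do rewrite -mulN1r.
apply: elementaryD; first exact: elementary_cst.
by apply: elementaryM; [exact: elementary_cst|exact: aff].
Qed.

Lemma box_bump_norm a b k x : `|box_bump a b k x| <= 1.
Proof.
rewrite /box_bump normr_prod; apply: prodr_ile1 => i _; rewrite normr_ge0/=.
have := @flat_ge0 R 0 (k.+1%:R * (x ord0 i - a ord0 i)).
have := flat0_le1 (k.+1%:R * (x ord0 i - a ord0 i)).
have := @flat_ge0 R 0 (k.+1%:R * (x ord0 i - b ord0 i)).
have := flat0_le1 (k.+1%:R * (x ord0 i - b ord0 i)).
move: (flat _ _) (flat _ _) => p q ? ? ? ?.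
by rewrite normrM mulr_ile1//; rewrite ger0_norm; lra.
Qed.

Lemma cvg_box_bump a b x : box_bump a b ^~ x @ \oo --> (\1_(box a b) x : R).
Proof.
have -> : \1_(box a b) x = \prod_(i < n) ((0 < x ord0 i - a ord0 i)%R%:R *
    (1 - (0 < x ord0 i - b ord0 i)%R%:R)) :> R.
  rewrite indicE; have [xab|] := boolP (x \in box a b).
    rewrite big1// => i _; move: xab; rewrite inE => /(_ i); rewrite in_itv/= => /andP[ax xb].
    by rewrite !subr_gt0 ax ltNge xb subr0 mulr1.
  move/negP; rewrite inE => /existsNP[i /negP]; rewrite in_itv/= negb_and => H.
  apply/esym/eqP; rewrite prodf_seq_eq0; apply/hasP; exists i; first by rewrite mem_index_enum.
  rewrite !subr_gt0 /= mulf_eq0; case/orP: H => [/negbTE ->|]; first by rewrite eqxx.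
  by rewrite -ltNge => ->; rewrite subrr eqxx orbT.
apply: cvg_big => [|i _]; first exact: mul_continuous.
apply: cvgM; first exact: cvg_flat0_scale.
by apply: cvgB; [exact: cvg_cst|exact: cvg_flat0_scale].
Qed.

(* The fundamental lemma of the calculus of variations on the unit ball:
   [w * cutoff r] integrates to zero over boxes, hence over all measurable
   sets, for each [r < 1]. *)
Lemma test_function_ae0 w : Defs.locally_integrable B w ->
  (forall phi, test_function B phi -> \int[mu]_(x in B) (w x * phi x) = 0) ->
  ae_eq mu B w (cst 0).
Proof.
move=> lw w0; have mw : measurable_fun B w by case: lw.
have mbump (a b : E) k : measurable_fun B (box_bump a b k).
  apply: measurable_funTS; apply: continuous_measurable_rV.
  exact: elementary_continuous (elementary_box_bump a b k).
have key r : 0 <= r < 1 -> ae_eq mu B (fun x => w x * cutoff r x) (cst 0).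
  move=> r01; have r0 : 0 <= r by case/andP : r01.
  have cK := compact_cball r0; have KB := cball_sub_eball r01.
  have test f : elementary f -> test_function B (fun x => f x * cutoff r x).
    move=> ef; apply: supported_test_function cK KB _.
      exact/elementaryM/elementary_cutoff.
    exact/supportedM/supported_cutoff.
  pose g x := w x * cutoff r x.
  have gi : mu.-integrable B (EFin \o g).
    apply: (locally_integrable_mul mB lw cK KB); last exact: supported_cutoff.
    exact: elementary_continuous (elementary_cutoff r).
  have mg : measurable_fun B g.
    by have /integrableP[/measurable_EFinP] := gi.
  (* A pi-lambda argument: the sets [S] over which [g] integrates to zero contain the boxes and are
     stable under complements and countable disjoint unions. *)
  have P0 (S : set E) : measurable S -> (\int[mu]_(x in B `&` S) (g x)%:E)%E = 0%E.
    move=> mS; rewrite measurable_rVE in mS.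
    apply: (@dynkin_induction _ E boxes
      (fun S => (\int[mu]_(x in B `&` S) (g x)%:E)%E = 0%E)) mS.
    - exact: measurable_rVE.
    - exact: setI_closed_boxes.
    - rewrite setIT EFin_Rintegral//; congr EFin.
      have := w0 _ (test _ (elementary_cst 1)).
      by under eq_Rintegral do rewrite mul1r.
    - move=> _ [[a b] _ <-] /=; rewrite integral_mkcondr.
      rewrite (_ : (EFin \o g) \_ (box a b) = fun x => (g x * \1_(box a b) x)%:E); last first.
        by apply/funext => x; rewrite patchE indicE; case: ifPn; rewrite ?mulr1 ?mulr0.
      (* The bumps replace the indicator of the box, with majorant [|g|]; each approximating
         integral is zero because [box_bump a b k] times [cutoff r] is a test function. *)
      have gbi k : mu.-integrable B (EFin \o (fun x => g x * box_bump a b k x)).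
        apply: (le_integrable_EFin mB (g := fun x => `|g x|)).
        - exact: measurable_funM.
        - by move=> x _; rewrite normrM ler_piMr// box_bump_norm.
        - exact: integrable_norm gi.
      have [||||_ _ lim] := @dominated_convergence _ _ _ mu B mB
        (fun k x => (g x * box_bump a b k x)%:E) (fun x => (g x * \1_(box a b) x)%:E)
        (EFin \o (fun x => `|g x|)) (fun k => measurable_int _ (gbi k)).
      + apply/measurable_EFinP; apply: measurable_funM => //.
        by apply: measurable_indic; exact: measurable_box.
      + apply: aeW => x _; apply/cvg_EFin; first exact: nearW.
        by apply: cvgMl_tmp; exact: cvg_box_bump.
      + exact: integrable_norm gi.
      + by apply: aeW => x k _; rewrite lee_fin normrM ler_piMr// box_bump_norm.
      move/cvg_lim : lim => <- //; apply/cvg_lim => //.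
      apply: cvg_near_cst; apply: nearW => k /=; rewrite EFin_Rintegral//; congr EFin.
      rewrite -[RHS](w0 _ (test _ (elementary_box_bump a b k))).
      by apply: eq_Rintegral => x _; rewrite /g mulrAC mulrA.
    - move=> A mA A0.
      have : (\int[mu]_(x in B) (g x)%:E)%E = 0%E.
        rewrite EFin_Rintegral//; congr EFin.
        have := w0 _ (test _ (elementary_cst 1)).
        by under eq_Rintegral do rewrite mul1r.
      rewrite -{1}(setIT B) -(setUv A) setIUr integral_setU_EFin//.
      + by rewrite A0 add0e.
      + exact: measurableI.
      + by apply: measurableI => //; exact: measurableC.
      + by rewrite -setIUr setUv setIT.
      + by apply/disj_setPS => x [[_ ?] [_]].
    - move=> F mF tF F0; rewrite setI_bigcupr integral_bigcup.
      + by apply: eseries0 => k _ _; exact: F0.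
      + exact: trivIset_setIl.
      + by move=> k; exact: measurableI.
      + apply: integrableS gi => //.
          by apply: bigcup_measurable => k _; exact: measurableI.
        by rewrite -setI_bigcupr; exact: subIsetl.
  have : ae_eq mu B (EFin \o g) (cst 0%E).
    apply: integral_ae_eq => // S SB mS.
    by rewrite integral0 -(setIidr SB) P0.
  by apply: filterS => x H Bx; have := H Bx => /= -[].
(* Countably many radii increasing to 1: each point of the open unit ball is in one of these smaller
   balls, where the cutoff is positive and can be divided out. *)
pose r (k : nat) : R := 1 - k.+1%:R^-1.
have r01 k : 0 <= r k < 1.
  by rewrite /r subr_ge0 invf_le1// ler1n/= gtrBl invr_gt0.
have := ae_foralln (fun k => key (r k) (r01 k)).
apply: filterS => x H Bx.
have [k xk] : exists k, sqn x < r k ^+ 2.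
  have lim : (fun k => r k ^+ 2) @ \oo --> (1 - 0 : R) ^+ 2.
    have rl : r @ \oo --> (1 - 0 : R) by apply: cvgB; [exact: cvg_cst|exact: cvg_harmonic].
    exact: (cvgM rl rl).
  have : \forall k \near \oo, sqn x < r k ^+ 2.
    apply: (cvgr_gt _ lim); move: Bx; rewrite eballE//= expr1n => ?.
    by rewrite subr0 expr1n.
  by move=> /filter_ex.
have /eqP := H k Bx; rewrite mulf_eq0 => /predU1P[//|].
by rewrite gt_eqF// flat0_gt0// subr_gt0.
Qed.

End fundamental_lemma.

(** * Square integrable functions, uniqueness of weak derivatives, and affine functions *)

Section weak_derivatives.
Context {R : realType} {n : nat}.
Local Notation E := 'rV[R]_n.
Local Notation mu := (@lebesgue_rV R n).
Local Notation B := (eball n (1 : R)).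
Implicit Types (u v w f phi : E -> R) (i j : 'I_n).

Let mB : measurable B. Proof. exact: measurable_eball. Qed.
Let Boo : (mu B < +oo)%E. Proof. exact: lebesgue_eball_lty. Qed.

Lemma L2P u : L2 B u <->
  measurable_fun B u /\ mu.-integrable B (EFin \o (fun x => u x ^+ 2)).
Proof.
have sq : (\int[mu]_(x in B) `|(EFin \o (fun x => u x ^+ 2)%R) x|)%E =
    (\int[mu]_(x in B) (u x ^+ 2)%:E)%E.
  by apply: eq_integral => x _ /=; rewrite ger0_norm// sqr_ge0.
split=> -[mu_ ui]; split=> //.
  apply/integrableP; split.
    by apply/measurable_EFinP; exact: measurable_funX.
  by rewrite sq; apply: (lty_poweRy (r := 2^-1)) => //; rewrite invr_eq0.
by move/integrableP: ui => [_]; rewrite sq; exact: poweR_lty.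
Qed.

Lemma L2normE u : L2 B u ->
  L2norm B u = (Num.sqrt (\int[mu]_(x in B) (u x ^+ 2)))%:E.
Proof.
move=> /L2P[_ ui]; rewrite /L2norm EFin_Rintegral// poweR_EFin powR12_sqrt//.
by apply: Rintegral_ge0 => x _; exact: sqr_ge0.
Qed.

(** The ball has finite measure, so the majorant [u^2 + 1] is integrable. *)
Lemma L2_integrable u : L2 B u -> mu.-integrable B (EFin \o u).
Proof.
move=> /L2P[mu_ ui]; apply: (le_integrable_EFin mB (g := fun x => u x ^+ 2 + 1)) => //.
  by move=> x _; rewrite ler_norml; apply/andP; split; nra.
apply: integrable_EFinD => //.
by apply: (integrable_EFin_bounded mB (M := 1)) => // x _; rewrite normr1.
Qed.

Lemma L2_locally_integrable u : L2 B u -> Defs.locally_integrable B u.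
Proof.
move=> L2u; split; first by case: L2u.
move=> K cK KB; apply: integrableS KB (L2_integrable L2u) => //.
exact: compact_measurable_rV.
Qed.

Lemma bounded_L2 u (M : R) : measurable_fun B u -> (forall x, B x -> `|u x| <= M) -> L2 B u.
Proof.
move=> mu_ uM; apply/L2P; split=> //.
apply: (integrable_EFin_bounded mB (M := M ^+ 2)) => //; first exact: measurable_funX.
move=> x Bx; rewrite normrX lerXn2r ?nnegrE ?uM//.
exact: le_trans (uM x Bx).
Qed.

Lemma L2DZ u v (c : R) : L2 B u -> L2 B v -> L2 B (fun x => u x + c * v x).
Proof.
move=> /L2P[mu_ ui] /L2P[mv vi]; apply/L2P; split.
  by apply: measurable_funD => //; exact: measurable_funM.
rewrite (_ : (fun x => _) = (fun x => u x ^+ 2 + (2 * c) * (u x * v x) + c ^+ 2 * v x ^+ 2)).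
  apply: integrable_EFinD => //; last exact: integrable_EFinZ.
  apply: integrable_EFinD => //; apply: integrable_EFinZ => //.
  exact: integrable_EFin_mul.
by apply/funext => x; ring.
Qed.

Lemma ae_eq_L2 u v : measurable_fun B v -> ae_eq mu B u v -> L2 B u -> L2 B v.
Proof.
move=> mv uv /L2P[mu_ ui]; apply/L2P; split=> //.
apply: (ae_eq_integrable mB _ _ _ ui); [exact: measurable_funX..|].
by apply: filterS uv => x H /H ->.
Qed.

(** The difference [v - w] integrates to zero against every test function, so [test_function_ae0]
    applies. *)
Lemma weak_partial_unique i u v w :
  is_weak_partial B i u v -> is_weak_partial B i u w -> ae_eq mu B v w.
Proof.
move=> [lu lv uv] [_ lw uw].
have : ae_eq mu B (fun x => v x + (-1) * w x) (cst 0).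
  apply: test_function_ae0; first exact: locally_integrableDZ.
  move=> phi tphi; under eq_Rintegral do rewrite mulrDl -mulrA.
  have vi := test_mul_integrable mB lv tphi.
  have wi := test_mul_integrable mB lw tphi.
  rewrite RintegralD// ?RintegralZl//; last exact: integrable_EFinZ.
  apply/eqP; rewrite mulN1r subr_eq0 -eqr_opp; apply/eqP.
  by rewrite -uv// -uw.
by apply: filterS => x H /H /= /eqP; rewrite mulN1r subr_eq0 => /eqP.
Qed.

(** Existence of one weak derivative rules out the default value of [weak_partial]; uniqueness then
    identifies the chosen representative with [v] almost everywhere. *)
Lemma weak_partialP i u v : is_weak_partial B i u v ->
  is_weak_partial B i u (weak_partial B i u) /\ ae_eq mu B v (weak_partial B i u).
Proof.
move=> uv; have H : is_weak_partial B i u (weak_partial B i u).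
  by rewrite /weak_partial; apply: (@xgetPex _ _ [set v | is_weak_partial B i u v]); exists v.
by split=> //; exact: weak_partial_unique H.
Qed.

Lemma is_weak_partial_measurable i u v : is_weak_partial B i u v -> measurable_fun B v.
Proof. by case=> _ []. Qed.

Lemma W12P u : W12 B u -> L2 B u /\ forall i,
  is_weak_partial B i u (weak_partial B i u) /\ L2 B (weak_partial B i u).
Proof.
move=> [L2u uv]; split=> // i; have [v L2v iv] := uv i.
have [H ae] := weak_partialP iv; split=> //.
exact: ae_eq_L2 (is_weak_partial_measurable H) ae L2v.
Qed.

Definition affine (a : R) (b : 'I_n -> R) (x : E) : R := a + \sum_j b j * x ord0 j.

Lemma continuous_affine a b : continuous (affine a b).
Proof.
move=> x; have ca : (fun _ : E => a) @ x --> a by exact: cst_continuous.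
apply: (cvgD ca); apply: cvg_big => [|j _]; first exact: add_continuous.
by apply: cvgMl_tmp; exact: coord_continuous.
Qed.

Lemma is_derive_affine a b i x : is_derive x (delta_mx ord0 i : E) (affine a b) (b i).
Proof.
have H : (fun h : R => h^-1 *: ((affine a b \o shift x) (h *: (delta_mx ord0 i : E)) - affine a b x))
    @ 0^' --> b i.
  apply: cvg_near_cst; near=> h.
  have -> : (affine a b \o shift x) (h *: (delta_mx ord0 i : E)) - affine a b x = h * b i.
    rewrite /affine /= (bigD1 i)//= [X in _ - (_ + X)](bigD1 i)//= !mxE !eqxx/= mulr1.
    rewrite (eq_bigr (fun j => b j * x ord0 j)); first by ring.
    by move=> j ji; rewrite !mxE (negbTE ji) andbF mulr0 add0r.
  rewrite [_ *: _]mulrA mulVf ?mul1r//; near: h; exact: nbhs_dnbhs_neq.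
by apply: DeriveDef; [apply/cvg_ex; exists (b i)|exact/cvg_lim].
Unshelve. all: by end_near. Qed.

Lemma measurable_affine a b (D : set E) : measurable_fun D (affine a b).
Proof.
apply: measurable_funTS; apply: continuous_measurable_rV; exact: continuous_affine.
Qed.

Lemma affine_L2 a b : L2 B (affine a b).
Proof.
apply: (bounded_L2 (M := `|a| + \sum_j `|b j|)); first exact: measurable_affine.
move=> x; rewrite eballE//= expr1n => /ltW x1; rewrite (le_trans (ler_normD _ _))// lerD2l.
rewrite (le_trans (ler_norm_sum _ _ _))// ler_sum// => j _.
by rewrite normrM ler_piMr// (coor_le j ler01)// expr1n.
Qed.

Lemma cst_L2 (a : R) : L2 B (cst a).
Proof. by apply: (bounded_L2 (M := `|a|)). Qed.

(** Integration by parts: [d] below is the classical partial derivative of [affine a b] times [phi],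
    and its integral vanishes by [Rintegral_partial0]. *)
Lemma is_weak_partial_affine a b i : is_weak_partial B i (affine a b) (cst (b i)).
Proof.
have la := L2_locally_integrable (affine_L2 a b).
have lb := L2_locally_integrable (cst_L2 (b i)).
split=> // phi tphi; have [_ cK KB] := tphi.
have cphi := test_function_continuous tphi.
have cdphi := @test_function_partial _ _ _ i _ tphi.
pose g x := affine a b x * phi x.
pose d x := affine a b x * partial i phi x + phi x * b i.
have cg : continuous g by move=> x; exact: (cvgM (continuous_affine (x := x)) (cphi x)).
have cd : continuous d.
  move=> x; have c1 := cvgM (@continuous_affine a b x) (cdphi x).
  have c2 := cvgM (cphi x) (@cst_continuous _ _ (b i) x).
  exact: (cvgD (c1 _) (c2 _)).
have g0 : supported (support phi) g by apply: supportedM; exact: support_supported.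
have d0 : supported (support phi) d.
  move=> x Kx; have p0 : phi x = 0 by exact: support_supported.
  have dp0 : partial i phi x = 0 by exact: (@supported_partial _ _ i phi).
  by rewrite /d p0 dp0 mulr0 mul0r addr0.
have gd x : is_derive x (delta_mx ord0 i : E) g (d x).
  exact: (is_deriveM (is_derive_affine a b i x) (test_function_is_derive i x tphi)).
have [Mg gM] := supported_bounded cK cg g0.
have [Md dM] := supported_bounded cK cd d0.
(* The support of [phi] lies in the unit ball, whence the bound 1 on the coordinates in
   [Rintegral_partial0]. *)
have out1 (x : E) j : 1 < `|x ord0 j| -> ~ support phi x.
  move=> xj /KB; rewrite eballE//= => /ltW x1.
  by have := coor_le j ler01 x1; rewrite leNgt xj.
have mg : measurable_fun setT g by exact: continuous_measurable_rV.
have md : measurable_fun setT d by exact: continuous_measurable_rV.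
have [] := @Rintegral_partial0 R n i g d 1 Md ler01 mg md.
- apply: (@integrable_rV_bounded_support _ _ (const_mx (- 2)) (const_mx 2) Mg) => //.
  move=> x /existsNP[j /negP]; rewrite in_itv/= !mxE negb_and -leNgt -ltNge => xj.
  apply: g0; apply: (out1 _ j); rewrite ltr_normr.
  by case/orP: xj => xj; apply/orP; [right|left]; lra.
- by move=> x j /out1 /g0.
- by move=> x h /andP[h0 _]; exact: (is_derive_lipschitz gd dM).
- by apply: aeW => x; exact: is_derive_cvg.
move=> _ intd.
have intB : \int[mu]_(x in B) d x = 0.
  rewrite -[RHS]intd Rintegral_mkcond; apply: eq_Rintegral => x _.
  rewrite patchE; case: ifPn => // /negP; rewrite inE => xB.
  by rewrite d0// => /KB.
move: intB; rewrite /d.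
have i1 := test_mul_partial_integrable i mB la tphi.
have i2 := test_mul_integrable mB lb tphi.
under eq_Rintegral do rewrite [_ * b i]mulrC.
by rewrite RintegralD// => /eqP; rewrite addr_eq0 => /eqP.
Qed.

End weak_derivatives.

(** * The affine projection *)

Section affine_projection.
Context {R : realType} {n : nat}.
Local Notation E := 'rV[R]_n.
Local Notation mu := (@lebesgue_rV R n).
Local Notation B := (eball n (1 : R)).
Implicit Types (u v w f : E -> R) (i j : 'I_n).

Let mB : measurable B. Proof. exact: measurable_eball. Qed.
Let Boo : (mu B < +oo)%E. Proof. exact: lebesgue_eball_lty. Qed.
Let m : R := fine (mu B).

Let m_gt0 : 0 < m.
Proof. by rewrite fine_gt0// Boo andbT lebesgue_eball_gt0. Qed.

Lemma eball_subset (r s : R) : 0 < r <= s -> eball n r `<=` eball n s.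
Proof. by move=> /andP[_ rs] x /lt_le_trans; exact. Qed.

Lemma fine_lebesgue_eball (r : R) : 0 < r -> fine (mu (eball n r)) = r ^+ n * m.
Proof. by move=> r0; rewrite lebesgue_eball_scale// fineM// lebesgue_eball_fin. Qed.

Lemma cst_integrable_eball (r c : R) : 0 < r ->
  mu.-integrable (eball n r) (EFin \o (fun _ : E => c)).
Proof.
move=> r0; apply: (integrable_EFin_bounded (measurable_eball r0) (M := `|c|)) => //.
exact: lebesgue_eball_lty.
Qed.

Lemma affine_integrable_eball (r a : R) (b : 'I_n -> R) : 0 < r ->
  mu.-integrable (eball n r) (EFin \o affine a b).
Proof.
move=> r0; have mr := @measurable_eball R n r r0.
apply: integrable_EFinD => //; first exact: cst_integrable_eball.
by apply: integrable_EFin_sum => // i; apply: integrable_EFinZ => //; exact: coor_integrable.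
Qed.

(** First moments of a centred ball vanish, so only the constant term survives. *)
Lemma average_affine (r a : R) (b : 'I_n -> R) : 0 < r ->
  average (eball n r) (affine a b) = a.
Proof.
move=> r0; have mr := @measurable_eball R n r r0.
rewrite /average RintegralD//; last 2 first.
- exact: cst_integrable_eball.
- by apply: integrable_EFin_sum => // i; apply: integrable_EFinZ => //; exact: coor_integrable.
rewrite Rintegral_cst// Rintegral_sumr; last 2 first.
- by [].
- by move=> i; apply: integrable_EFinZ => //; exact: coor_integrable.
rewrite big1 ?addr0.
  by rewrite mulrCA mulVf ?mulr1// fine_lebesgue_eball// gt_eqF// mulr_gt0// exprn_gt0.
by move=> i _; rewrite RintegralZl// ?Rintegral_coor ?mulr0//; exact: coor_integrable.
Qed.

Lemma averageDZ (r c : R) u v : 0 < r ->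
  mu.-integrable (eball n r) (EFin \o u) -> mu.-integrable (eball n r) (EFin \o v) ->
  average (eball n r) (fun x => u x + c * v x) =
  average (eball n r) u + c * average (eball n r) v.
Proof.
move=> r0 ui vi; have mr := @measurable_eball R n r r0.
rewrite /average RintegralD//; last exact: integrable_EFinZ.
by rewrite RintegralZl// mulrDr mulrCA.
Qed.

Lemma integrable_eball_sub (r : R) u : 0 < r <= 1 -> mu.-integrable B (EFin \o u) ->
  mu.-integrable (eball n r) (EFin \o u).
Proof.
move=> r01; have /andP[r0 _] := r01; apply: integrableS => //.
- exact: measurable_eball.
- exact: eball_subset.
Qed.

Lemma Rintegral_sqrBZ w (D : set E) (A : R) : measurable D -> (mu D < +oo)%E ->
  mu.-integrable D (EFin \o w) ->
  mu.-integrable D (EFin \o (fun x => w x ^+ 2)) ->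
  \int[mu]_(x in D) ((w x - A) ^+ 2) =
  \int[mu]_(x in D) (w x ^+ 2) - 2 * A * \int[mu]_(x in D) w x + A ^+ 2 * fine (mu D).
Proof.
move=> mD Doo wi w2.
have ci : mu.-integrable D (EFin \o (fun _ : E => A ^+ 2)).
  by apply: (integrable_EFin_bounded mD (M := `|A ^+ 2|)).
rewrite (@eq_Rintegral _ _ _ mu D (fun x => w x ^+ 2 - 2 * A * w x + A ^+ 2)); last by move=> x _; ring.
have i1 := integrable_EFinZ mD (2 * A) wi.
rewrite RintegralD//; last exact: integrable_EFinB.
by rewrite RintegralB// RintegralZl// Rintegral_cst.
Qed.

(** Jensen's inequality as nonnegativity of a variance: the integral of [(w - A)^2] over the small
    ball is expanded, with [A] the average there. The measure [r^n m] of that ball yields the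
    factor, and the domain is then enlarged to [B]. *)
Lemma sqr_average_le (r : R) w : 0 < r <= 1 -> L2 B w ->
  m * average (eball n r) w ^+ 2 <= (r ^+ n)^-1 * \int[mu]_(x in B) (w x ^+ 2).
Proof.
move=> r01 Lw; have /andP[r0 r1] := r01; have mr := @measurable_eball R n r r0.
have /L2P[mw w2] := Lw.
have w2r := integrable_eball_sub r01 w2.
have wr := integrable_eball_sub r01 (L2_integrable Lw).
set A := average _ w; have rn0 : 0 < r ^+ n by exact: exprn_gt0.
have AE : \int[mu]_(x in eball n r) w x = r ^+ n * m * A.
  by rewrite /A /average -fine_lebesgue_eball// mulVKf// fine_lebesgue_eball// gt_eqF// mulr_gt0.
have : 0 <= \int[mu]_(x in eball n r) ((w x - A) ^+ 2).
  by apply: Rintegral_ge0 => x _; exact: sqr_ge0.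
rewrite Rintegral_sqrBZ//; last exact: lebesgue_eball_lty.
rewrite AE fine_lebesgue_eball// => H.
have H2 : \int[mu]_(x in eball n r) (w x ^+ 2) <= \int[mu]_(x in B) (w x ^+ 2).
  rewrite /Rintegral fine_le//.
  - exact: integrable_fin_num.
  - exact: integrable_fin_num.
  apply: ge0_subset_integral => //; last exact: eball_subset.
    by case/integrableP: w2.
  by move=> x _; rewrite lee_fin sqr_ge0.
rewrite ler_pdivlMl//; apply: le_trans H2; rewrite -subr_ge0; apply: le_trans H _.
by rewrite le_eqVlt; apply/orP; left; apply/eqP; ring.
Qed.

(** The cross terms vanish by the first moments, and the square of the linear part is evaluated by
    [Rintegral_coor2]. *)
Lemma Rintegral_sqr_affine (a : R) (b : 'I_n -> R) :
  \int[mu]_(x in B) (affine a b x ^+ 2) =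
  m * (a ^+ 2 + (\sum_i b i ^+ 2) / (n%:R + 2)).
Proof.
pose l (x : E) : R := \sum_i b i * x ord0 i.
have bi i j : mu.-integrable B (EFin \o (fun x : E => b i * b j * (x ord0 i * x ord0 j))).
  by apply: integrable_EFinZ => //; exact: coor2_integrable.
have li : mu.-integrable B (EFin \o l).
  by apply: integrable_EFin_sum => // i; apply: integrable_EFinZ => //; exact: coor_integrable.
have l2E : (fun x => l x ^+ 2) = (fun x => \sum_i \sum_j b i * b j * (x ord0 i * x ord0 j)).
  apply/funext => x; rewrite expr2 /l mulr_suml; apply: eq_bigr => i _.
  by rewrite mulr_sumr; apply: eq_bigr => j _; ring.
have l2i : mu.-integrable B (EFin \o (fun x => l x ^+ 2)).
  by rewrite l2E; apply: integrable_EFin_sum => // i; exact: integrable_EFin_sum.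
rewrite (@eq_Rintegral _ _ _ mu B (fun x => (l x - - a) ^+ 2)); last first.
  by move=> x _; rewrite /affine opprK addrC.
rewrite Rintegral_sqrBZ//.
have -> : \int[mu]_(x in B) l x = 0.
  rewrite Rintegral_sumr//; last first.
    by move=> i; apply: integrable_EFinZ => //; exact: coor_integrable.
  by rewrite big1// => i _; rewrite RintegralZl// ?Rintegral_coor ?mulr0//; exact: coor_integrable.
rewrite l2E Rintegral_sumr//; last by move=> i; exact: integrable_EFin_sum.
rewrite (eq_bigr (fun i => m / (n%:R + 2) * b i ^+ 2)); last first.
  move=> i _; rewrite Rintegral_sumr// (bigD1 i)//= big1 ?addr0.
    rewrite RintegralZl//; last exact: coor2_integrable.
    by rewrite Rintegral_coor2 eqxx mul1r -/m; ring.
  move=> j ji; rewrite RintegralZl//; last exact: coor2_integrable.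
  by rewrite Rintegral_coor2 eq_sym (negbTE ji) mul0r mulr0.
by rewrite -mulr_sumr -/m; ring.
Qed.

(** With averages [A] and [b], the left side is [m (A^2 + |b|^2/(n+2) + |b|^2)], and
    [1 + 1/(n+2) = (n+3)/(n+2)]. The [q i] are arbitrary, so the bound serves both for [u] and for
    [u] minus an affine function. *)
Lemma affine_average_le (r : R) w (q : 'I_n -> E -> R) : 0 < r <= 1 ->
  L2 B w -> (forall i, L2 B (q i)) ->
  \int[mu]_(x in B) (affine (average (eball n r) w) (fun i => average (eball n r) (q i)) x ^+ 2) +
  \sum_i \int[mu]_(x in B) (average (eball n r) (q i) ^+ 2) <=
  (n%:R + 3) / (n%:R + 2) * (r ^+ n)^-1 *
  (\int[mu]_(x in B) (w x ^+ 2) + \sum_i \int[mu]_(x in B) (q i x ^+ 2)).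
Proof.
move=> r01 Lw Lq; set F := eball n r; have /andP[r0 _] := r01.
rewrite Rintegral_sqr_affine.
rewrite [X in _ + X <= _](eq_bigr (fun i => average F (q i) ^+ 2 * m)); last first.
  by move=> i _; rewrite Rintegral_cst.
rewrite -mulr_suml.
set S := \sum_i _ ^+ 2; set A := average F w.
have n2 : 0 < n%:R + 2 :> R by rewrite ltr_wpDl.
set c : R := (n%:R + 3) / (n%:R + 2).
have c1 : 1 <= c by rewrite /c ler_pdivlMr// mul1r lerD2l ler_nat.
have cE : 1 + (n%:R + 2)^-1 = c by rewrite /c; field; rewrite gt_eqF.
have hA : m * A ^+ 2 <= (r ^+ n)^-1 * \int[mu]_(x in B) (w x ^+ 2) by exact: sqr_average_le.
have hS : m * S <= (r ^+ n)^-1 * \sum_i \int[mu]_(x in B) (q i x ^+ 2).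
  by rewrite /S !mulr_sumr; apply: ler_sum => i _; exact: sqr_average_le.
rewrite [leLHS](_ : _ = m * A ^+ 2 + c * (m * S)); last by rewrite -cE; ring.
(* The coefficient 1 of [m * A ^+ 2] is enlarged to [c >= 1], so that both terms share one
   constant. *)
apply: (@le_trans _ _ (c * (m * A ^+ 2 + m * S))).
  by rewrite mulrDr lerD2r ler_peMl// mulr_ge0 ?sqr_ge0// ltW.
rewrite -mulrA ler_wpM2l//; first by apply: le_trans c1.
by rewrite mulrDr lerD.
Qed.

(* The pointwise inequality [(w - z)^2 <= (1 + c) w^2 + (1 + c^-1) z^2]
   replaces Minkowski's inequality. *)
Lemma Rintegral_sqrB_le w z (c : R) : 0 < c -> L2 B w -> L2 B z ->
  \int[mu]_(x in B) ((w x - z x) ^+ 2) <=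
  (1 + c) * \int[mu]_(x in B) (w x ^+ 2) + (1 + c^-1) * \int[mu]_(x in B) (z x ^+ 2).
Proof.
move=> c0 Lw Lz; have /L2P[mw w2] := Lw; have /L2P[mz z2] := Lz.
have /L2P[_ wz2] := L2DZ (-1) Lw Lz.
rewrite -!RintegralZl// -RintegralD//; [|exact: integrable_EFinZ..].
apply: le_Rintegral => //.
- by apply: eq_integrable wz2 => // x _ /=; rewrite mulN1r.
- by apply: integrable_EFinD => //; exact: integrable_EFinZ.
move=> x _; rewrite -subr_ge0.
rewrite (_ : _ - _ = c^-1 * (c * w x + z x) ^+ 2).
  by rewrite mulr_ge0 ?sqr_ge0// invr_ge0 ltW.
by field; rewrite gt_eqF.
Qed.

End affine_projection.

(** * Sobolev norms *)

Section sobolev_norms.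
Context {R : realType} {n : nat}.
Local Notation E := 'rV[R]_n.
Local Notation mu := (@lebesgue_rV R n).
Local Notation B := (eball n (1 : R)).
Implicit Types (u v w f : E -> R) (i j : 'I_n).

Let mB : measurable B. Proof. exact: measurable_eball. Qed.

Definition sqint u : R := \int[mu]_(x in B) (u x ^+ 2).

Lemma sqint_ge0 u : 0 <= sqint u.
Proof. by apply: Rintegral_ge0 => x _; exact: sqr_ge0. Qed.

Lemma ae_eq_sqint u v : L2 B u -> L2 B v -> ae_eq mu B u v -> sqint u = sqint v.
Proof.
move=> [mu_ _] [mv _] uv; apply: ae_eq_Rintegral => //; try exact: measurable_funX.
by apply: filterS uv => x H /H ->.
Qed.

Lemma L2_weak_partial i u v : L2 B v -> is_weak_partial B i u v ->
  L2 B (weak_partial B i u) /\ sqint (weak_partial B i u) = sqint v.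
Proof.
move=> Lv uv; have [H ae] := weak_partialP uv.
have Lw := ae_eq_L2 (is_weak_partial_measurable H) ae Lv.
by split=> //; apply/esym; exact: ae_eq_sqint.
Qed.

(** Since [hess] differentiates the chosen first derivative, this is what allows second derivatives
    to be computed from any other representative. *)
Lemma ae_eq_is_weak_partialr i j u v w : is_weak_partial B i u v ->
  is_weak_partial B j v w -> is_weak_partial B j (weak_partial B i u) w.
Proof.
move=> uv vw; have [H ae] := weak_partialP uv.
have mw := is_weak_partial_measurable vw.
apply: ae_eq_is_weak_partial vw => //.
- exact: is_weak_partial_measurable H.
- exact: ae_eq_refl.
Qed.

Lemma W12_intro u (p : 'I_n -> E -> R) : L2 B u ->
  (forall i, L2 B (p i)) -> (forall i, is_weak_partial B i u (p i)) -> W12 B u.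
Proof. by move=> Lu Lp up; split=> // i; exists (p i). Qed.

(** Membership may be checked on any family of representatives, not only on those selected by
    [weak_partial]. *)
Lemma W22_intro u (p : 'I_n -> E -> R) (h : 'I_n -> 'I_n -> E -> R) : L2 B u ->
  (forall i, L2 B (p i)) -> (forall i, is_weak_partial B i u (p i)) ->
  (forall i j, L2 B (h i j)) -> (forall i j, is_weak_partial B j (p i) (h i j)) ->
  W22 B u.
Proof.
move=> Lu Lp up Lh ph; split; first exact: W12_intro up.
move=> i; apply: (W12_intro (p := h i)) => //.
- by have [] := L2_weak_partial (Lp i) (up i).
- by move=> j; exact: ae_eq_is_weak_partialr (up i) (ph i j).
Qed.

Lemma integrable_sqr u : L2 B u -> mu.-integrable B (EFin \o (fun x => u x ^+ 2)).
Proof. by case/L2P. Qed.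

Lemma L2norm_grad u (p : 'I_n -> E -> R) :
  (forall i, L2 B (p i)) -> (forall i, is_weak_partial B i u (p i)) ->
  L2norm B (fun x => fnorm (grad B u x)) = (Num.sqrt (\sum_i sqint (p i)))%:E.
Proof.
move=> Lp up.
have wp i := L2_weak_partial (Lp i) (up i).
have i1 i := integrable_sqr (wp i).1.
rewrite /L2norm (eq_integral (fun x => (\sum_i weak_partial B i u x ^+ 2)%:E)); last first.
  by move=> x _; rewrite sqr_fnorm_rV /sqn; congr EFin; apply: eq_bigr => i _; rewrite mxE.
rewrite EFin_Rintegral//; last exact: integrable_EFin_sum.
rewrite poweR_EFin powR12_sqrt; last first.
  by apply: Rintegral_ge0 => x _; apply: sumr_ge0 => i _; exact: sqr_ge0.
rewrite Rintegral_sumr//; congr (Num.sqrt _)%:E; apply: eq_bigr => i _.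
by rewrite -(wp i).2.
Qed.

Lemma L2norm_hess u (h : 'I_n -> 'I_n -> E -> R) :
  (forall i j, L2 B (h i j)) ->
  (forall i j, is_weak_partial B j (weak_partial B i u) (h i j)) ->
  L2norm B (fun x => fnorm (hess B u x)) = (Num.sqrt (\sum_i \sum_j sqint (h i j)))%:E.
Proof.
move=> Lh uh.
have wp i j := L2_weak_partial (Lh i j) (uh i j).
have i1 i j := integrable_sqr (wp i j).1.
have i2 i : mu.-integrable B (EFin \o (fun x => \sum_j weak_partial B j (weak_partial B i u) x ^+ 2)).
  exact: integrable_EFin_sum.
rewrite /L2norm (eq_integral (fun x =>
  (\sum_i \sum_j weak_partial B j (weak_partial B i u) x ^+ 2)%:E)); last first.
  move=> x _; rewrite sqr_fnorm; congr EFin; apply: eq_bigr => i _; apply: eq_bigr => j _.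
  by rewrite mxE.
rewrite EFin_Rintegral//; last exact: integrable_EFin_sum.
rewrite poweR_EFin powR12_sqrt; last first.
  apply: Rintegral_ge0 => x _; apply: sumr_ge0 => i _; apply: sumr_ge0 => j _.
  exact: sqr_ge0.
rewrite Rintegral_sumr//; congr (Num.sqrt _)%:E; apply: eq_bigr => i _.
by rewrite Rintegral_sumr//; apply: eq_bigr => j _; rewrite -(wp i j).2.
Qed.

(** The norm as a real number, computed from arbitrary representatives; later estimates thereby
    become inequalities between finite sums of [sqint]. *)
Lemma W22normE u (p : 'I_n -> E -> R) (h : 'I_n -> 'I_n -> E -> R) : L2 B u ->
  (forall i, L2 B (p i)) -> (forall i, is_weak_partial B i u (p i)) ->
  (forall i j, L2 B (h i j)) -> (forall i j, is_weak_partial B j (p i) (h i j)) ->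
  W22norm B u = (Num.sqrt (sqint u + \sum_i sqint (p i) + \sum_i \sum_j sqint (h i j)))%:E.
Proof.
move=> Lu Lp up Lh ph.
have wp i := L2_weak_partial (Lp i) (up i).
have wh i j := L2_weak_partial (Lh i j) (ae_eq_is_weak_partialr (up i) (ph i j)).
have i0 := integrable_sqr Lu.
have i1 i := integrable_sqr (wp i).1.
have i2 i j := integrable_sqr (wh i j).1.
have i3 : mu.-integrable B (EFin \o (fun x => \sum_i weak_partial B i u x ^+ 2)).
  exact: integrable_EFin_sum.
have i4 i : mu.-integrable B (EFin \o (fun x => \sum_j weak_partial B j (weak_partial B i u) x ^+ 2)).
  exact: integrable_EFin_sum.
have i5 : mu.-integrable B (EFin \o (fun x =>
    \sum_i \sum_j weak_partial B j (weak_partial B i u) x ^+ 2)).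
  exact: integrable_EFin_sum.
have i6 := integrable_EFinD mB i0 i3.
rewrite /W22norm (eq_integral (fun x => (u x ^+ 2 + \sum_i weak_partial B i u x ^+ 2 +
  \sum_i \sum_j weak_partial B j (weak_partial B i u) x ^+ 2)%:E)); last first.
  move=> x _; rewrite sqr_fnorm_rV sqr_fnorm /sqn; congr (_ + _ + _)%:E.
    by apply: eq_bigr => i _; rewrite mxE.
  by apply: eq_bigr => i _; apply: eq_bigr => j _; rewrite mxE.
rewrite EFin_Rintegral//; last exact: integrable_EFinD.
rewrite poweR_EFin powR12_sqrt; last first.
  apply: Rintegral_ge0 => x _; rewrite !addr_ge0 ?sqr_ge0// sumr_ge0// => i _.
    exact: sqr_ge0.
  by apply: sumr_ge0 => j _; exact: sqr_ge0.
rewrite RintegralD// RintegralD// !Rintegral_sumr//; congr (Num.sqrt (_ + _ + _))%:E.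
  by apply: eq_bigr => i _; rewrite -(wp i).2.
apply: eq_bigr => i _.
by rewrite Rintegral_sumr//; apply: eq_bigr => j _; rewrite -(wh i j).2.
Qed.

Lemma sqint_cst (c : R) : sqint (cst c) = \int[mu]_(x in B) (c ^+ 2).
Proof. by []. Qed.

Lemma sqint0 : sqint (cst 0) = 0.
Proof. by rewrite sqint_cst expr0n/= Rintegral_cst// mul0r. Qed.

Lemma affine_cst (c : R) : affine c (fun=> 0) = cst c :> (E -> R).
Proof.
apply/funext => x; rewrite /affine big1 ?addr0// => j _.
by rewrite mul0r.
Qed.

Lemma average_cst (r c : R) : 0 < r -> average (eball n r) (cst c : E -> R) = c.
Proof. by move=> r0; rewrite -affine_cst average_affine. Qed.

Lemma is_weak_partial_cst (c : R) i : is_weak_partial B i (cst c : E -> R) (cst 0).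
Proof.
by have := is_weak_partial_affine c (fun=> 0) i; rewrite affine_cst.
Qed.

(** Puts the Poincare inequality into squared form. *)
Lemma le_sqrtM (Q x y : R) : 0 <= Q -> 0 <= x -> 0 <= y ->
  Num.sqrt x <= Q * Num.sqrt y -> x <= Q ^+ 2 * y.
Proof.
move=> Q0 x0 y0; rewrite -[Q in Q * _](ger0_norm Q0) -sqrtr_sqr -sqrtrM ?sqr_ge0//.
by rewrite ler_sqrt// mulr_ge0// sqr_ge0.
Qed.

End sobolev_norms.

(** * The operator norm bound and the approximation estimate *)

Theorem mainTheorem7 (R : realType) (n : nat) (rho Q : R)
  (n_gt0 : (0 < n)%N) (rho_gt0 : 0 < rho) (rho_lt1 : rho < 1) (Q_gt0 : 0 < Q)
  (poincare : forall u : 'rV[R]_n -> R, W12 (eball n 1) u ->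
    (L2norm (eball n 1) (fun x => u x - average (eball n 1) u)%R
     <= Q%:E * L2norm (eball n 1) (fun x => fnorm (grad (eball n 1) u x)))%E) :
  let B : set 'rV[R]_n := eball n 1 in
  let T : ('rV[R]_n -> R) -> 'rV[R]_n -> R :=
    affine_approx B (eball n rho) in
  let C : R := Num.sqrt ((n%:R + 3) / (n%:R + 2)) * (1 / rho) `^ (n%:R / 2) in
  [/\ forall u : 'rV[R]_n -> R, W22 B u -> W22 B (T u),
      (W22_opnorm B T <= C%:E)%E
    & forall u : 'rV[R]_n -> R, W22 B u ->
        (W22norm B (fun x => u x - T u x)%R
         <= ((1 + C) * (1 + Q ^+ 2 + Q ^+ 4) `^ (1 / 2))%:E
            * L2norm B (fun x => fnorm (hess B u x)))%E].
Proof.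
move=> B T C.
have rho01 : 0 < rho <= 1 by rewrite rho_gt0 ltW.
have c_gt0 : 0 < (n%:R + 3) / (n%:R + 2) :> R.
  by rewrite divr_gt0// ltr_wpDl.
have C_gt0 : 0 < C.
  by apply: mulr_gt0; [rewrite sqrtr_gt0|apply: powR_gt0; rewrite divr_gt0].
(* Squaring removes the square root and the real power; all estimates below compare squared
   norms. *)
have CE : C ^+ 2 = (n%:R + 3) / (n%:R + 2) * (rho ^+ n)^-1.
  rewrite /C exprMn sqr_sqrtr ?(ltW c_gt0)//; congr (_ * _).
  rewrite -[LHS]powR_mulrn ?powR_ge0// -powRrM divfK ?pnatr_eq0// powR_mulrn ?divr_ge0 ?ltW//.
  by rewrite div1r exprVn.
have TE u : T u = affine (average (eball n rho) u)
    (fun i => average (eball n rho) (weak_partial B i u)).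
  apply/funext => x; rewrite /T /affine_approx /affine center_of_mass_eball//.
  congr (_ + _); apply: eq_bigr => i _; rewrite mxE subr0; congr (average _ _ * _).
  by apply/funext => y; rewrite mxE.
have W22T a b : W22 B (affine a b).
  apply: (W22_intro (p := fun i => cst (b i)) (h := fun _ _ => cst 0)).
  - exact: affine_L2.
  - by move=> i; exact: cst_L2.
  - by move=> i; exact: is_weak_partial_affine.
  - by move=> i j; exact: cst_L2.
  - by move=> i j; exact: is_weak_partial_cst.
split; first by move=> u _; rewrite TE.
- apply: ub_ereal_sup => _ [u [W22u u1] <-].
  have [/W12P[Lu up] Wp] := W22u.
  have ph i := W12P (Wp i).
  move: u1; rewrite (W22normE (p := fun i => weak_partial B i u)
      (h := fun i j => weak_partial B j (weak_partial B i u)) Lu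
      (fun i => (up i).2) (fun i => (up i).1) (fun i j => ((ph i).2 j).2)
      (fun i j => ((ph i).2 j).1)).
  rewrite lee_fin -sqrtr1 ler_sqrt// => Nu.
  rewrite TE (W22normE (p := fun i => cst (average (eball n rho) (weak_partial B i u)))
     (h := fun _ _ => cst 0)); [|exact: affine_L2|by move=> i; exact: cst_L2|
     by move=> i; exact: is_weak_partial_affine|by move=> i j; exact: cst_L2|
     by move=> i j; exact: is_weak_partial_cst].
  rewrite [X in _ + _ + X]big1 ?addr0; last by move=> i _; rewrite big1// => j _; exact: sqint0.
  rewrite lee_fin -[leRHS](ger0_norm (ltW C_gt0)) -sqrtr_sqr ler_sqrt ?sqr_ge0//.
  apply: le_trans (affine_average_le rho01 Lu (fun i => (up i).2)) _.
  (* The remaining quantity lacks only the second-order terms of [Nu], which are nonnegative. *)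
  rewrite -CE ler_piMr ?sqr_ge0//; apply: le_trans Nu; rewrite lerDl.
  by apply: sumr_ge0 => i _; apply: sumr_ge0 => j _; exact: sqint_ge0.
move=> u W22u; have [/W12P[Lu up] Wp] := W22u.
have ph i := W12P (Wp i).
pose p i := weak_partial B i u; pose h i j := weak_partial B j (p i).
have Lp i : L2 B (p i) by have [] := up i.
have up1 i : is_weak_partial B i u (p i) by have [] := up i.
have Lh i j : L2 B (h i j) by have [_ /(_ j)[]] := ph i.
have ph1 i j : is_weak_partial B j (p i) (h i j) by have [_ /(_ j)[]] := ph i.
pose F := eball n rho : set 'rV[R]_n.
pose a := average F u; pose b i := average F (p i).
(* Averages over the whole ball: [affine al be] is the comparison function that makes the Poincare
   inequality applicable. *)
pose al := average B u; pose be i := average B (p i).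
have mB : measurable B by exact: measurable_eball.
pose H := \sum_i \sum_j sqint (h i j).
have H_ge0 : 0 <= H by apply: sumr_ge0 => i _; apply: sumr_ge0 => j _; exact: sqint_ge0.
(* The shape [u + (-1) * v] is the one treated by [L2DZ] and [is_weak_partialDZ]. *)
pose w x := u x + (-1) * affine al be x.
pose q i x := p i x + (-1) * cst (be i) x.
have Lw : L2 B w by apply: L2DZ => //; exact: affine_L2.
have Lq i : L2 B (q i) by apply: L2DZ => //; exact: cst_L2.
have wq i : is_weak_partial B i w (q i).
  by apply: is_weak_partialDZ => //; exact: is_weak_partial_affine.
pose S := sqint w + \sum_i sqint (q i).
have HS : S <= (Q ^+ 2 + Q ^+ 4) * H.
  (* Poincare for the partial derivative [p i]; its deviation from its average over [B] is [q i]. *)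
  have q_le i : sqint (q i) <= Q ^+ 2 * \sum_j sqint (h i j).
    have := poincare _ (Wp i); rewrite -/B -/(p i) (L2norm_grad (Lh i) (ph1 i)).
    rewrite (_ : (fun x => p i x - average B (p i)) = q i); last first.
      by apply/funext => x; rewrite /q mulN1r.
    rewrite (L2normE (Lq i)) -EFinM lee_fin; apply: le_sqrtM; first exact: ltW.
      exact: sqint_ge0.
    by apply: sumr_ge0 => j _; exact: sqint_ge0.
  (* Poincare for [w], whose average over [B] is 0 because [u] and [affine al be] have the same
     average. *)
  have w_le : sqint w <= Q ^+ 2 * \sum_i sqint (q i).
    have := poincare _ (W12_intro Lw Lq wq); rewrite -/B (L2norm_grad Lq wq).
    rewrite (_ : average B w = 0); last first.
      rewrite averageDZ ?average_affine ?mulN1r ?subrr//; first exact: L2_integrable.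
      exact: affine_integrable_eball.
    rewrite (_ : (fun x => w x - 0) = w); last by apply/funext => x; rewrite subr0.
    rewrite (L2normE Lw) -EFinM lee_fin; apply: le_sqrtM; first exact: ltW.
      exact: sqint_ge0.
    by apply: sumr_ge0 => i _; exact: sqint_ge0.
  have sum_le : \sum_i sqint (q i) <= Q ^+ 2 * H by rewrite mulr_sumr; exact: ler_sum.
  rewrite /S; have Q2 : 0 <= Q ^+ 2 by exact: sqr_ge0.
  have := ler_wpM2l Q2 sum_le; move: w_le sum_le.
  rewrite (_ : Q ^+ 4 = Q ^+ 2 * Q ^+ 2); last by rewrite -exprD.
  by move=> ? ? ?; lra.
(* This is the affine function that [T] assigns to [w]: [a - al] and [b i - be i] are the averages
   of [w] and [q i] over the small ball. *)
pose z := affine (a - al) (fun i => b i - be i).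
have core : sqint z + \sum_i sqint (cst (b i - be i) : 'rV[R]_n -> R) <= C ^+ 2 * S.
  have := affine_average_le rho01 Lw Lq; rewrite -CE.
  have -> : average (eball n rho) w = a - al.
    rewrite averageDZ ?average_affine ?mulN1r//.
      by apply: integrable_eball_sub rho01 _; exact: L2_integrable.
    exact: affine_integrable_eball.
  have bE i : average (eball n rho) (q i) = b i - be i.
    rewrite averageDZ ?average_cst ?mulN1r//.
      by apply: integrable_eball_sub rho01 _; exact: L2_integrable.
    exact: cst_integrable_eball.
  have -> : (fun i => average (eball n rho) (q i)) = (fun i => b i - be i).
    exact/funext.
  by under [X in _ + X <= _]eq_bigr do rewrite bE.
rewrite (_ : (fun x => u x - T u x) = (fun x => u x + (-1) * affine a b x)); last first.
  by apply/funext => x; rewrite TE mulN1r.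
rewrite (W22normE (p := fun i x => p i x + (-1) * cst (b i) x)
  (h := fun i j x => h i j x + (-1) * cst 0 x)); first last.
- by move=> i j; apply: is_weak_partialDZ => //; exact: is_weak_partial_cst.
- by move=> i j; apply: L2DZ => //; exact: cst_L2.
- by move=> i; apply: is_weak_partialDZ => //; exact: is_weak_partial_affine.
- by move=> i; apply: L2DZ => //; exact: cst_L2.
- by apply: L2DZ => //; exact: affine_L2.
rewrite (L2norm_hess Lh ph1) -/H -EFinM lee_fin.
have -> : \sum_i \sum_j sqint (fun x => h i j x + (-1) * cst 0 x) = H.
  apply: eq_bigr => i _; apply: eq_bigr => j _; congr sqint.
  by apply/funext => x; rewrite mulr0 addr0.
(* Here [u - T u = w - z], and the free weight in [Rintegral_sqrB_le] is set to [C]. *)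
have u_le : sqint (fun x => u x + (-1) * affine a b x) <=
    (1 + C) * sqint w + (1 + C^-1) * sqint z.
  have zE x : z x = affine a b x - affine al be x.
    by rewrite /z /affine; under eq_bigr do rewrite mulrBl; rewrite sumrB; ring.
  apply: le_trans (Rintegral_sqrB_le C_gt0 Lw (affine_L2 (a - al) (fun i => b i - be i))).
  rewrite le_eqVlt; apply/orP; left; apply/eqP; congr sqint; apply/funext => x.
  by rewrite -/(z x) zE /w; ring.
have p_le i : sqint (fun x => p i x + (-1) * cst (b i) x) <=
    (1 + C) * sqint (q i) + (1 + C^-1) * sqint (cst (b i - be i) : 'rV[R]_n -> R).
  apply: le_trans (Rintegral_sqrB_le C_gt0 (Lq i) (cst_L2 _)).
  rewrite le_eqVlt; apply/orP; left; apply/eqP; congr sqint; apply/funext => x.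
  by rewrite /q /=; ring.
have ps_le := ler_sum (index_enum _) (P := predT) (fun i _ => p_le i).
rewrite big_split/= -!mulr_sumr in ps_le.
have D_ge0 : 0 <= 1 + Q ^+ 2 + Q ^+ 4 by rewrite !addr_ge0// exprn_ge0// ltW.
rewrite div1r powR12_sqrt// -mulrA -sqrtrM// -[X in X * _](ger0_norm (_ : 0 <= 1 + C)); last first.
  by rewrite addr_ge0// ltW.
rewrite -sqrtr_sqr -sqrtrM ?sqr_ge0// ler_sqrt; last first.
  by rewrite mulr_ge0 ?sqr_ge0// mulr_ge0.
(* The weight [C] makes the constants combine: [(1 + C) S + (1 + 1/C) C^2 S = (1 + C)^2 S], as the
   triangle inequality would give. *)
apply: (@le_trans _ _ ((1 + C) ^+ 2 * S + H)).
  rewrite lerD2r; apply: le_trans (lerD u_le ps_le) _.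
  rewrite [leLHS](_ : _ = (1 + C) * S + (1 + C^-1) *
    (sqint z + \sum_i sqint (cst (b i - be i) : 'rV[R]_n -> R))); last by rewrite /S; ring.
  apply: (@le_trans _ _ ((1 + C) * S + (1 + C^-1) * (C ^+ 2 * S))).
    by rewrite lerD2l ler_wpM2l// addr_ge0// invr_ge0 ltW.
  by rewrite le_eqVlt; apply/orP; left; apply/eqP; field; rewrite gt_eqF.
(* The Hessian term carries the factor 1 only, which is at most [(1 + C)^2]; this accounts for the
   summand 1 in [1 + Q^2 + Q^4]. *)
rewrite [leRHS](_ : _ = (1 + C) ^+ 2 * ((Q ^+ 2 + Q ^+ 4) * H) + (1 + C) ^+ 2 * H); last by ring.
apply: lerD; first by rewrite ler_wpM2l ?sqr_ge0.
by rewrite ler_peMl// expr_ge1 ?lerDl ?addr_ge0 ?(ltW C_gt0).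
Qed.
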